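(* Let $\alpha>0$ and let $G$ be a graph with $m\ge 1$ edges such that every cut of $G$ has at most $m/2+\alpha\sqrt{m}$ edges. Then $G$ contains a clique of size at least $2^{-O(\alpha^9)}\sqrt{m}$, where the implicit constant in $O(\cdot)$ is absolute (independent of $G$, $m$ and $\alpha$).
   Context: All graphs are finite and simple. A cut of $G$ is a partition of $V(G)$ into two sets; its size is the number of edges with exactly one endpoint in each part. *)

(* Defs.v *)
From mathcomp Require Import all_boot.

Set Implicit Arguments.
Unset Strict Implicit.
Unset Printing Implicit Defensive.

Record sgraph := SGraph {
  vertex :> finType;
  adj : rel vertex;
  adj_sym : symmetric adj;
  adj_irrefl : irreflexive adj
}.

(* Edges are unordered pairs, so each adjacency is counted once. *)
Definition edges (G : sgraph) : {set {set G}} :=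
  [set f : {set G} | [exists x, exists y, adj x y && (f == [set x; y])]].

(* A cut is the bipartition (A, ~: A) of the vertex set, given by one of its
   sides; a side may be empty, which only adds cuts of size 0. *)
Definition cut_edges (G : sgraph) (A : {set G}) : {set {set G}} :=
  [set f in edges G | [exists x in A, exists y in ~: A, f == [set x; y]]].

Definition cut_size (G : sgraph) (A : {set G}) : nat := #|cut_edges A|.

Definition is_clique (G : sgraph) (K : {set G}) : Prop :=
  forall x y : G, x \in K -> y \in K -> x != y -> adj x y.

(* Main.v *)
(** Write sigma = 4 alpha sqrt m. Since the quadratic form of the adjacency matrix is
    affine in each coordinate, the bound on cuts says that it is at least -sigma on
    the whole cube [-1, 1]^V. Disjointly supported vectors can be combined with
    suitable signs, so vertex-disjoint pieces on which the form is at most -c times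
    the number of vertices cover at most sigma / c vertices.

    - Deleting the vertices of degree above 4 sqrt m, and then everything outside a
      maximal matching, leaves a set U of at most 4 alpha sqrt m vertices that still
      spans a positive proportion of the m edges.
    - If many triples (v, u, w) of U were cherries (v adjacent to u and w, which are
      distinct and not adjacent), then the Kovari-Sos-Turan argument, applied twice,
      would produce blow-ups of a cherry with parts T1, T2, T3 of size t of order
      alpha^4; there 1_T2 + 1_T3 - 1_T1 has value at most -t^2, whatever the edges
      inside the parts. This step needs sqrt m >= 2^(C t^2 log alpha), which is the
      source of the exponent alpha^9.
    - Hence some neighbourhood S has at least sqrt m / (64 alpha) vertices and at most
      eps |S|^2 nonadjacent pairs, with eps of order alpha^-2. Choose a maximal set of
      arcs in the complement of S with out-degrees at most D and in-degrees at most
      4 D, for D of order alpha^4. If it is small, a greedy argument finds a clique of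
      size |S| / (16 k^2), with D = 2 k^2. Otherwise rounding a sum of random signs
      along the arcs yields a vector of mean zero, hence insensitive to the all-ones
      part of the adjacency matrix, which correlates along the arcs and makes the form
      less than -sigma. *)

Require Import Defs.
From mathcomp Require Import all_boot all_order all_algebra.
From mathcomp Require Import complex.
From mathcomp Require Import all_reals all_analysis.
From mathcomp Require Import boolp.
From mathcomp Require Import zify ring lra.
Import Order.TTheory GRing.Theory Num.Theory.
Set Implicit Arguments.
Unset Strict Implicit.
Unset Printing Implicit Defensive.
Local Open Scope ring_scope.

(** * The quadratic form of a graph *)

Section QuadraticForm.
Variables (R : realFieldType) (V : finType) (e : rel V).
Hypotheses (esym : symmetric e) (eirr : irreflexive e).

Definition bform (x y : V -> R) : R := \sum_u \sum_v (e u v)%:R * x u * y v.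
Definition qform (x : V -> R) : R := bform x x.
Definition ind (X : {set V}) (u : V) : R := (u \in X)%:R.
Definition arcs (X Y : {set V}) : R := bform (ind X) (ind Y).

Lemma eq_bform x x' y y' : x =1 x' -> y =1 y' -> bform x y = bform x' y'.
Proof.
by move=> hx hy; apply: eq_bigr => u _; apply: eq_bigr => v _; rewrite hx hy.
Qed.

Lemma bformC x y : bform x y = bform y x.
Proof.
rewrite /bform exchange_big; apply: eq_bigr => u _; apply: eq_bigr => v _.
by rewrite esym mulrAC.
Qed.

Lemma bform_linearl c x x' y :
  bform (fun u => x u + c * x' u) y = bform x y + c * bform x' y.
Proof.
rewrite /bform mulr_sumr -big_split; apply: eq_bigr => u _ /=.
rewrite mulr_sumr -big_split; apply: eq_bigr => v _ /=; ring.
Qed.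

Lemma bform_linearr c x y y' :
  bform x (fun u => y u + c * y' u) = bform x y + c * bform x y'.
Proof. by rewrite bformC bform_linearl !(bformC x). Qed.

Lemma qformD c x y :
  qform (fun u => x u + c * y u) = qform x + 2 * c * bform x y + c ^+ 2 * qform y.
Proof.
rewrite /qform bform_linearl !bform_linearr (bformC y x); ring.
Qed.

Lemma arcsE (X Y : {set V}) :
  arcs X Y = \sum_(u in X) \sum_(v in Y) (e u v)%:R.
Proof.
rewrite /arcs /bform [RHS]big_mkcond; apply: eq_bigr => u _ /=.
rewrite /ind; case: (u \in X) => /=; last first.
  by rewrite big1 // => v _; rewrite mulr0 mul0r.
rewrite [RHS]big_mkcond; apply: eq_bigr => v _ /=.
by case: (v \in Y) => /=; rewrite ?mulr1 ?mulr0.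
Qed.

Lemma arcs_le X Y : arcs X Y <= #|X|%:R * #|Y|%:R.
Proof.
rewrite arcsE mulr_natl -sumr_const; apply: ler_sum => u _.
rewrite -[in leRHS]sum1_card natr_sum.
by apply: ler_sum => v _; case: (e u v).
Qed.

Lemma qform_ind_sub (X Y : {set V}) :
  qform (fun u => ind X u + (-1) * ind Y u) = arcs X X + arcs Y Y - 2 * arcs X Y.
Proof. by rewrite qformD /arcs /qform; ring. Qed.

Lemma qform_ind_add (X Y : {set V}) :
  qform (fun u => ind X u + 1 * ind Y u) = arcs X X + arcs Y Y + 2 * arcs X Y.
Proof. by rewrite qformD /arcs /qform; ring. Qed.

Lemma arcs_setD (X Y : {set V}) : X \subset Y ->
  arcs Y Y = arcs X X + arcs (Y :\: X) (Y :\: X) + 2 * arcs X (Y :\: X).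
Proof.
move=> sXY; rewrite -qform_ind_add /arcs /qform.
have h : ind Y =1 (fun u => ind X u + 1 * ind (Y :\: X) u).
  move=> u; rewrite mul1r /ind inE; case: (boolP (u \in X)) => /= uX.
    by rewrite (subsetP sXY) // addr0.
  by rewrite add0r.
exact: eq_bform.
Qed.

Lemma qform_delta u : qform (fun w => (w == u)%:R) = 0.
Proof.
rewrite /qform /bform big1 // => w _; rewrite big1 // => v _.
case: eqP => [->|_]; last by rewrite mulr0 mul0r.
by case: eqP => [->|_]; rewrite ?eirr ?mul0r ?mulr0.
Qed.

(** The diagonal of [e] vanishes, so the form is affine in each coordinate and its minimum along
    that coordinate is at an endpoint. The coordinates in a list are pushed to 1 or -1 one at a
    time; a vector with all entries 1 or -1 is a cut. *)
Lemma qform_extreme (x : V -> R) : (forall u, `|x u| <= 1) ->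
  exists B : {set V}, qform (fun u => ind B u + (-1) * ind (~: B) u) <= qform x.
Proof.
move=> hx.
have /(_ (enum V)) [y [hy1 hy2 hy3]] : forall l : seq V, exists y : V -> R,
    [/\ forall u, u \in l -> y u = 1 \/ y u = -1, forall u, `|y u| <= 1
      & qform y <= qform x].
  elim=> [|u l [y [hy1 hy2 hy3]]]; first by exists x; split.
  pose x0 w := y w + (- y u) * (w == u)%:R.
  pose b := bform x0 (fun w => (w == u)%:R).
  (* With coordinate [u] set to zero in [x0], the form at [x0 + c * delta_u] has slope [2 * b] in
     [c], so the sign opposite to [b] is at least as good as [y u]. *)
  pose tau : R := if 0 <= b then -1 else 1.
  have tau1 : tau = 1 \/ tau = -1 by rewrite /tau; case: ifP; [right|left].
  have x0E c w : x0 w + c * (w == u)%:R = if w == u then c else y w.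
    by rewrite /x0; case: eqP => [->|_]; rewrite ?mulr1 ?mulr0 ?addr0 // addrN add0r.
  exists (fun w => x0 w + tau * (w == u)%:R); split.
  - move=> w; rewrite inE x0E; case: eqP => //= _ wl; exact: hy1.
  - move=> w; rewrite x0E; case: eqP => // _.
    by case: tau1 => ->; rewrite ?normrN normr1.
  - apply: le_trans hy3.
    have -> : qform y = qform (fun w => x0 w + y u * (w == u)%:R).
      by apply: eq_bform => w; rewrite x0E; case: eqP => [->|].
    rewrite !qformD qform_delta !mulr0 !addr0 lerD2l -!mulrA ler_wpM2l //.
    rewrite -/b /tau; have := hy2 u; rewrite ler_norml => /andP[h1 h2].
    case: ifP => [b0|/negbT]; first by nra.
    rewrite -ltNge => b0; nra.
exists [set u | y u == 1]; apply: le_trans hy3.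
have -> // : qform y = qform (fun u => ind [set u | y u == 1] u
                          + (-1) * ind (~: [set u | y u == 1]) u).
have h u : y u = ind [set u | y u == 1] u + (-1) * ind (~: [set u | y u == 1]) u.
  rewrite /ind !inE; case: (hy1 u (mem_enum _ _)) => ->; first by rewrite eqxx /=; ring.
  case: eqP => [h|_]; last by rewrite /=; ring.
  by have := @ltr01 R; rewrite -h; lra.
exact: eq_bform.
Qed.

(** Asked on the whole cube rather than at its corners, so that centred and rounded vectors can be
    tested as well as cuts. *)
Definition bounded_surplus (sigma : R) :=
  forall x : V -> R, (forall u, `|x u| <= 1) -> - sigma <= qform x.

Definition surplus_on (c : R) (Z : {set V}) := exists x : V -> R,
  [/\ forall u, `|x u| <= 1, forall u, u \notin Z -> x u = 0
    & qform x <= - (c * #|Z|%:R)].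

Lemma surplus_on_card c Z sigma :
  bounded_surplus sigma -> surplus_on c Z -> c * #|Z|%:R <= sigma.
Proof. by move=> hs [x [/hs h _]]; lra. Qed.

Lemma surplus_on0 c : surplus_on c set0.
Proof.
exists (fun=> 0); split=> [u||]; rewrite ?normr0 ?ler01 //.
rewrite cards0 mulr0 oppr0 /qform /bform big1 // => u _.
by rewrite big1 // => v _; rewrite mulr0.
Qed.

(* One of [x + y] and [x - y] does at least as well as the two pieces together. *)
Lemma surplus_onU c (Z W : {set V}) : [disjoint Z & W] ->
  surplus_on c Z -> surplus_on c W -> surplus_on c (Z :|: W).
Proof.
move=> dZW [x [x1 xZ qx]] [y [y1 yW qy]].
pose d : R := if 0 <= bform x y then -1 else 1.
have d1 : d = 1 \/ d = -1 by rewrite /d; case: ifP; [right|left].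
exists (fun u => x u + d * y u); split.
- move=> u; case: (boolP (u \in Z)) => uZ.
    by rewrite yW ?mulr0 ?addr0 // (disjointFr dZW).
  by rewrite xZ // add0r; case: d1 => ->; rewrite ?mulN1r ?normrN ?mul1r.
- move=> u; rewrite inE negb_or => /andP[uZ uW].
  by rewrite xZ // yW // mulr0 addr0.
- rewrite qformD cardsU.
  rewrite (disjoint_setI0 dZW).
  rewrite cards0 subn0 natrD mulrDr opprD.
  have -> : d ^+ 2 = 1 by case: d1 => ->; rewrite ?sqrrN expr1n.
  have : d * bform x y <= 0.
    rewrite /d; case: ifP => [h|/negbT]; rewrite ?mulN1r ?oppr_le0 ?mul1r //.
    by rewrite -ltNge; exact: ltW.
  lra.
Qed.

(** A set [Z] of maximum cardinality works: by [surplus_onU], any further nonempty piece in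
    [Y :\: Z] could be added to it. Since [surplus_on_card] bounds [Z], all obstructions of one kind
    are removed at the cost of few vertices. *)
Lemma surplus_packing c (Y : {set V}) : exists Z : {set V},
  [/\ Z \subset Y, surplus_on c Z
    & forall W : {set V}, W \subset Y :\: Z -> surplus_on c W -> W = set0].
Proof.
pose P (Z : {set V}) := `[< Z \subset Y /\ surplus_on c Z >].
have P0 : P set0 by apply/asboolP; split; [exact: sub0set | exact: surplus_on0].
case: (@arg_maxnP _ set0 P (fun Z => #|Z|) P0) => Z /asboolP[sZ cZ] maxZ.
exists Z; split=> // W sW cW; apply/eqP; rewrite -cards_eq0.
have dZW : [disjoint Z & W].
  by rewrite disjoint_sym; apply: disjointWl sW _; rewrite -setI_eq0 setIDAC setDIl setDv setI0.
have : (#|Z :|: W| <= #|Z|)%N.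
  apply: maxZ; apply/asboolP; split; last exact: surplus_onU.
  by rewrite subUset sZ (subset_trans sW) // subsetDl.
by rewrite cardsU (disjoint_setI0 dZW) cards0 subn0 -[X in (_ <= X)%N]addn0 leq_add2l leqn0.
Qed.

Lemma edge_surplus u v : e u v -> surplus_on 1 [set u; v].
Proof.
move=> euv; have uv : u != v by apply/eqP => uv; rewrite uv eirr in euv.
exists (fun w => ind [set u] w + (-1) * ind [set v] w); split.
- move=> w; rewrite /ind !inE; case: eqP => [->|_]; last first.
    by case: (w == v); rewrite /= add0r mulN1r normrN ?normr1 ?normr0.
  by rewrite (negbTE uv) mulr0 addr0 normr1.
- move=> w; rewrite /ind !inE negb_or => /andP[/negbTE-> /negbTE->].
  by rewrite mulr0 addr0.
- rewrite qform_ind_sub !arcsE !big_set1 !eirr euv cards2 uv /=; lra.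
Qed.

(* The packing consists of disjoint edges, so its complement in [Y] is independent. *)
Lemma dense_core sigma (Y : {set V}) : bounded_surplus sigma ->
  exists U : {set V}, [/\ U \subset Y, #|U|%:R <= sigma
    & arcs Y Y <= 2 * arcs U U + sigma].
Proof.
move=> hs; have [U [sU cU maxU]] := surplus_packing 1 Y.
exists U; split=> //; first by have := surplus_on_card hs cU; rewrite mul1r.
have I0 : arcs (Y :\: U) (Y :\: U) = 0.
  rewrite arcsE big1 // => u uI; rewrite big1 // => v vI.
  case: (boolP (e u v)) => // /edge_surplus h.
  have /maxU/(_ h)/setP/(_ u) : [set u; v] \subset Y :\: U.
    by apply/subsetP => w; rewrite in_set2 => /orP[]/eqP->.
  by rewrite !inE eqxx.
have := arcs_setD sU; rewrite I0 => ->.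
have := hs (fun u => ind U u + (-1) * ind (Y :\: U) u).
rewrite qform_ind_sub I0 => h; suff /h : forall u, `|ind U u + (-1) * ind (Y :\: U) u| <= 1 by lra.
move=> u; rewrite /ind inE; case: (u \in U); case: (u \in Y);
  by rewrite /= ?mulr0 ?addr0 ?add0r ?mulN1r ?normrN ?normr1 ?normr0.
Qed.

(** Testing the form at [1_X - 1_(Y :\: X)] shows that the crossing arcs, counted in both
    directions, exceed the inner ones by at most [sigma]. *)
Lemma arcs_split_le sigma (X Y : {set V}) : bounded_surplus sigma -> X \subset Y ->
  arcs Y Y <= 2 * (arcs X X + arcs (Y :\: X) (Y :\: X)) + sigma.
Proof.
move=> hs sXY; rewrite (arcs_setD sXY).
have := hs (fun u => ind X u + (-1) * ind (Y :\: X) u).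
rewrite qform_ind_sub => h; suff /h : forall u, `|ind X u + (-1) * ind (Y :\: X) u| <= 1 by lra.
move=> u; rewrite /ind inE; case: (u \in X); case: (u \in Y);
  by rewrite /= ?mulr0 ?addr0 ?add0r ?mulN1r ?normrN ?normr1 ?normr0.
Qed.
End QuadraticForm.

(** * Blow-ups of cherries *)

Section KovariSosTuran.
Local Open Scope nat_scope.

Lemma sum_card_exchange (P Q : finType) (r : P -> Q -> bool) (A : {set P}) (B : {set Q}) :
  \sum_(x in A) #|[set y in B | r x y]| = \sum_(y in B) #|[set x in A | r x y]|.
Proof.
under eq_bigr do rewrite -sum1dep_card big_mkcondr.
under [RHS]eq_bigr do rewrite -sum1dep_card big_mkcondr.
exact: exchange_big.
Qed.

(** [T] is built one element at a time. Each new element is chosen by averaging and keeps a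
    proportion at least [2 ^ -(g + 2)] of the surviving [y]; restricting first to [y] of large
    degree costs a factor [2 ^ (g + 1)]. *)
Lemma kovari_sos_turan (P Q : finType) (r : P -> Q -> bool)
    (A : {set P}) (B : {set Q}) (g t : nat) :
    0 < #|A| -> 4 * t * 2 ^ g <= #|A| ->
    #|A| * #|B| <= 2 ^ g * \sum_(x in A) #|[set y in B | r x y]| ->
  exists T : {set P}, [/\ T \subset A, #|T| = t
    & #|B| <= 2 ^ ((g + 2) * t + g + 1) * #|[set y in B | [forall x in T, r x y]]|].
Proof.
move=> A0 tA dens.
pose N y := #|[set x in A | r x y]|.
(* Degree at least half the assumed average: the other [y] carry at most half of the incidences. *)
pose B' := [set y in B | #|A| <= 2 ^ g.+1 * N y].
have hB : #|B| <= 2 ^ g.+1 * #|B'|.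
  rewrite -(leq_pmul2l A0).
  have h1 : \sum_(y in B) N y <= #|B'| * #|A| + \sum_(y in B :\: B') N y.
    rewrite (big_setID B') /= leq_add2r (setIidPr _); last by apply/subsetP=> y; rewrite inE => /andP[].
    rewrite -sum_nat_const; apply: leq_sum => y _; apply: subset_leq_card.
    by apply/subsetP=> x; rewrite inE => /andP[].
  have h2 : 2 ^ g.+1 * \sum_(y in B :\: B') N y <= #|B| * #|A|.
    apply: leq_trans (_ : #|B :\: B'| * #|A| <= _); last first.
      by rewrite leq_mul2r subset_leq_card ?orbT // subsetDl.
    rewrite big_distrr -sum_nat_const; apply: leq_sum => y /=.
    by rewrite !inE => /andP[+ yB]; rewrite yB /= -ltnNge => /ltnW.
  move: dens; rewrite sum_card_exchange => dens.
  have : 2 ^ g.+1 * \sum_(y in B) N y <= 2 ^ g.+1 * (#|B'| * #|A| + \sum_(y in B :\: B') N y).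
    by rewrite leq_mul2l h1 orbT.
  rewrite -/N in dens; rewrite expnS in h2 *.
  move: dens h2; under eq_bigr do rewrite -/(N _).
  move: (\sum_(y in B) N y) (\sum_(y in B :\: B') N y) (2 ^ g) => S S2 p.
  rewrite !mulnDr !mulnA ![_ * p]mulnC !mulnA ![_ * #|A|]mulnC !mulnA; lia.
have [T [sT cT hT]] : exists T : {set P}, [/\ T \subset A, #|T| = t
    & #|B'| <= 2 ^ ((g + 2) * t) * #|[set y in B' | [forall x in T, r x y]]|].
  have : t <= t by [].
  elim: {-2}t => [_|j IH jt].
    exists set0; split; rewrite ?sub0set ?cards0 //.
    rewrite muln0 mul1n; apply: subset_leq_card; apply/subsetP => y yB.
    by rewrite inE yB; apply/forall_inP => x; rewrite inE.
  have [T [sT cT hT]] := IH (ltnW jt).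
  set Bj := [set y in B' | _] in hT.
  have jA : j < #|A| by have := expn_gt0 2 g; nia.
  (* Leaving out the [j < t] elements already chosen at most halves the degree of any [y] in [B'],
     because [4 * t * 2 ^ g <= #|A|]. So averaging over [A :\: T] still succeeds. *)
  have [x] : exists x, (x \in A :\: T) && (#|Bj| <= 2 ^ (g + 2) * #|[set y in Bj | r x y]|).
    apply/existsP; rewrite -[X in is_true X]negbK; apply/negP => /existsPn hx.
    have h1 : 2 ^ (g + 2) * \sum_(x in A :\: T) #|[set y in Bj | r x y]| < #|A :\: T| * #|Bj|.
      have cAT : #|A :\: T| = #|A| - j by rewrite cardsD (setIidPr sT) cT.
      have : 0 < #|A :\: T| by rewrite cAT subn_gt0.
      move=> /card_gt0P[x0 x0A].
      rewrite big_distrr -sum_nat_const /= (bigD1 x0) //= [X in _ < X](bigD1 x0) //=.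
      have hh x : x \in A :\: T -> 2 ^ (g + 2) * #|[set y in Bj | r x y]| < #|Bj|.
        by move=> xA; have := hx x; rewrite xA /= -ltnNge.
      rewrite -addSn leq_add ?hh // leq_sum // => x /andP[xA _].
      by rewrite ltnW ?hh.
    have h2 : #|A| * #|Bj| <= 2 ^ (g + 2) * \sum_(x in A :\: T) #|[set y in Bj | r x y]|.
      rewrite sum_card_exchange big_distrr mulnC -sum_nat_const /=; apply: leq_sum => y.
      rewrite !inE => /andP[/andP[yB yA] _].
      have h3 : N y <= #|[set x in A :\: T | r x y]| + j.
        rewrite -cT -cardsUI; apply: leq_trans (leq_addr _ _); apply: subset_leq_card.
        apply/subsetP => x; rewrite !inE => /andP[-> ->]; rewrite andbT.
        by case: (x \in T).
      move: yA tA jt h3; rewrite expnS expnD; nia.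
    have : #|A :\: T| * #|Bj| <= #|A| * #|Bj| by rewrite leq_mul2r subset_leq_card ?orbT // subsetDl.
    by move=> h3; have := leq_ltn_trans (leq_trans h3 h2) h1; rewrite ltnn.
  rewrite inE => /andP[/andP[xT xA] hx].
  exists (x |: T); split.
  - by rewrite subUset sub1set xA.
  - by rewrite cardsU1 xT cT.
  apply: leq_trans hT _; rewrite mulnS expnD [2 ^ (g + 2) * _]mulnC -mulnA leq_mul2l; apply/orP; right.
  apply: leq_trans hx _; rewrite leq_mul2l; apply/orP; right; apply: subset_leq_card.
  apply/subsetP => y; rewrite !inE => /andP[/andP[/andP[-> ->] /forall_inP h] rxy] /=.
  by apply/forall_inP => z; rewrite !inE => /orP[/eqP->|/h].
exists T; split=> //; apply: leq_trans hB _.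
rewrite -addnA addn1 expnD [2 ^ _ * 2 ^ g.+1]mulnC -mulnA leq_mul2l; apply/orP; right.
apply: leq_trans hT _; rewrite leq_mul2l; apply/orP; right; apply: subset_leq_card.
by apply/subsetP => y; rewrite !inE => /andP[/andP[-> _] ->].
Qed.

(** The first application, between vertices and pairs, gives [T1] and a set [Q1] of pairs of density
    [2 ^ -h]. The second, to [Q1] as a bipartite graph, gives [T2] with at least
    [2 ^ -k * #|U| >= t] common neighbours, among which [T3] is arbitrary. *)
Lemma tripartite (V : finType) (r : V -> V * V -> bool) (U : {set V}) (g t h k : nat) :
    h = (g + 2) * t + g + 1 -> k = (h + 2) * t + h + 1 ->
    0 < t -> t * 2 ^ k <= #|U| ->
    #|U| ^ 3 <= 2 ^ g * \sum_(v in U) #|[set p in setX U U | r v p]| ->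
  exists T1 T2 T3 : {set V},
    [/\ [/\ T1 \subset U, T2 \subset U & T3 \subset U], [/\ #|T1| = t, #|T2| = t & #|T3| = t]
      & forall v u w, v \in T1 -> u \in T2 -> w \in T3 -> r v (u, w)].
Proof.
move=> hE kE t0 tU dens.
have pw a b : a + 2 <= b -> 4 * t * 2 ^ a <= t * 2 ^ b.
  move=> ab; rewrite [4 * t]mulnC -mulnA leq_mul2l; apply/orP; right.
  by rewrite (_ : 4 = 2 ^ 2) // -expnD leq_exp2l // addnC.
have U0 : 0 < #|U| by apply: leq_trans tU; rewrite muln_gt0 t0 expn_gt0.
have [] := @kovari_sos_turan _ _ r U (setX U U) g t U0.
- by apply: leq_trans tU; apply: pw; nia.
- by rewrite cardsX; move: dens; rewrite !expnS expn0 muln1.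
rewrite -hE => T1 [sT1 cT1]; set Q1 := [set p in _ | _] => hQ1.
have [] := @kovari_sos_turan _ _ (fun u w => (u, w) \in Q1) U U h t U0.
- by apply: leq_trans tU; apply: pw; nia.
- move: hQ1; rewrite cardsX => hQ1; apply: leq_trans hQ1 _.
  rewrite leq_mul2l; apply/orP; right.
  rewrite -sum1_card; under [leqRHS]eq_bigr do rewrite -sum1dep_card.
  rewrite pair_big_dep /=; rewrite [leqRHS]big_mkcond [leqLHS]big_mkcond /=.
  apply: leq_sum => -[u w] _ /=; case: ifP => // h1.
  by move: (h1); rewrite inE => /andP[+ _]; rewrite inE /= => /andP[-> ->].
rewrite -kE => T2 [sT2 cT2]; set W := [set w in _ | _] => hW.
have tW : t <= #|W|.
  by rewrite -(leq_pmul2l (expn_gt0 2 k)) mulnC; apply: leq_trans hW.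
have [T3 sT3 cT3] : exists2 T3 : {set V}, T3 \subset W & #|T3| = t.
  have [s us ss] : exists2 s, uniq s & (size s = t) /\ {subset s <= W}.
    exists (take t (enum W)); first by rewrite take_uniq ?enum_uniq.
    split; first by rewrite size_take -cardE; case: ltngtP tW.
    by move=> x /mem_take; rewrite mem_enum.
  case: ss => ss sW; exists [set x in s].
    by apply/subsetP => x; rewrite inE; exact: sW.
  by rewrite cardsE (card_uniqP us).
exists T1, T2, T3; split=> //.
  split=> //; apply: subset_trans sT3 _; apply/subsetP=> w; by rewrite inE => /andP[].
move=> v u w vT uT /(subsetP sT3); rewrite inE => /andP[_ /forall_inP/(_ u uT)].
by rewrite inE => /andP[_ /forall_inP/(_ v vT)].
Qed.
End KovariSosTuran.

(** * The surplus of a blown-up cherry *)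

Section Cherries.
Variables (R : realFieldType) (V : finType) (e : rel V).
Hypotheses (esym : symmetric e) (eirr : irreflexive e).

Definition cherry (v : V) (p : V * V) :=
  [&& e v p.1, e v p.2, p.1 != p.2 & ~~ e p.1 p.2].

(** The three parts contribute at most [3 * t ^ 2] inside, [T2] and [T3] see nothing of each other,
    and the arcs to [T1] contribute [- 4 * t ^ 2]. The total [- t ^ 2] is spread over [3 * t]
    vertices, whence [t / 3]. *)
Lemma blowup_surplus (T1 T2 T3 : {set V}) t :
    [/\ #|T1| = t, #|T2| = t & #|T3| = t] -> (0 < t)%N ->
    (forall v u w, v \in T1 -> u \in T2 -> w \in T3 -> cherry v (u, w)) ->
  surplus_on e (t%:R / 3 : R) (T1 :|: (T2 :|: T3)).
Proof.
move=> [c1 c2 c3] t0 ch.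
have [v0 v0T] : exists v, v \in T1 by apply/card_gt0P; rewrite c1.
have [u0 u0T] : exists v, v \in T2 by apply/card_gt0P; rewrite c2.
have [w0 w0T] : exists v, v \in T3 by apply/card_gt0P; rewrite c3.
have d23 : [disjoint T2 & T3].
  apply/pred0P => x /=; apply/negP => /andP[x2 x3].
  by have /and4P[_ _ /=] := ch _ _ _ v0T x2 x3; rewrite eqxx.
have d1 : [disjoint T1 & T2 :|: T3].
  apply/pred0P => x /=; apply/negP => /andP[x1]; rewrite inE => /orP[x2|x3].
    by have /and4P[/=] := ch _ _ _ x1 x2 w0T; rewrite eirr.
  by have /and4P[_ /=] := ch _ _ _ x1 u0T x3; rewrite eirr.
set X := T2 :|: T3 in d1 *.
have X3 : X :\: T2 = T3.
  by rewrite /X setDUl setDv set0U; apply/setDidPl; rewrite disjoint_sym.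
have cX : #|X| = (t + t)%N by rewrite cardsU (disjoint_setI0 d23) cards0 subn0 c2 c3.
exists (fun u => ind R X u + (-1) * ind R T1 u); split.
- move=> u; rewrite /ind; case: (boolP (u \in T1)) => [/(disjointFr d1) -> | _].
    by rewrite mulr1 add0r normrN normr1.
  by rewrite mulr0 addr0; case: (u \in X); rewrite ?normr1 ?normr0.
- move=> u; rewrite inE negb_or /ind => /andP[/negbTE-> /negbTE->].
  by rewrite mulr0 addr0.
rewrite qform_ind_sub // cardsU (disjoint_setI0 d1) cards0 subn0 c1 cX.
rewrite (arcs_setD _ _ (_ : T2 \subset X)) ?subsetUl // X3.
have a23 : arcs R e T2 T3 = 0.
  rewrite arcsE big1 // => u u2; rewrite big1 // => w w3.
  by have /and4P[_ _ _ /=] := ch _ _ _ v0T u2 w3; case: (e u w).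
have aX1 : arcs R e X T1 = 2 * t%:R * t%:R.
  rewrite arcsE (eq_bigr (fun=> t%:R)).
    by rewrite sumr_const cX mulrnDr -[t%:R *+ t]mulr_natl; ring.
  move=> u uX; rewrite (eq_bigr (fun=> 1)) ?sumr_const ?c1 // => v v1.
  move: uX; rewrite inE => /orP[u2|u3].
    by have /and4P[/= + _ _ _] := ch _ _ _ v1 u2 w0T; rewrite esym => ->.
  by have /and4P[/= _ + _ _] := ch _ _ _ v1 u0T u3; rewrite esym => ->.
have := @arcs_le R V e T1 T1; have := @arcs_le R V e T2 T2; have := @arcs_le R V e T3 T3.
rewrite c1 c2 c3 a23 aX1 !natrD => h1 h2 h3.
have : t%:R / 3 * (t%:R + (t%:R + t%:R)) = t%:R * t%:R :> R by field.
move=> ->; lra.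
Qed.
End Cherries.

(** * Counting cherries, and a nearly complete neighbourhood *)

Section FewCherries.
Variables (R : realFieldType) (V : finType) (e : rel V).
Hypotheses (esym : symmetric e) (eirr : irreflexive e).

Definition cherries (Y : {set V}) : R :=
  \sum_(v in Y) \sum_(u in Y) \sum_(w in Y) (cherry e v (u, w))%:R.

Definition degree (Y : {set V}) (v : V) : R := \sum_(w in Y) (e v w)%:R.

Lemma paths_through_le (U Z : {set V}) (d : R) :
    (forall v, v \in U -> degree U v <= d) -> Z \subset U ->
  \sum_(z in Z) \sum_(v in U) \sum_(w in U) (e z v && e v w)%:R <= #|Z|%:R * d ^+ 2.
Proof.
move=> hd /subsetP sZ; rewrite mulr_natl -sumr_const.
apply: ler_sum => z /sZ zU.
apply: le_trans (_ : \sum_(v in U) (e z v)%:R * d <= _).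
  apply: ler_sum => v vU; case: (e z v) => /=; last by rewrite big1 ?mul0r.
  by rewrite mul1r hd.
rewrite -mulr_suml expr2 ler_wpM2r ?hd //.
by apply: le_trans (hd z zU); apply: sumr_ge0.
Qed.

(** A deleted vertex can be the centre or either leaf of a cherry, and in each of these three roles
    it lies in at most [d ^ 2] cherries. *)
Lemma cherries_delete (U Z : {set V}) (d : R) :
    (forall v, v \in U -> degree U v <= d) -> Z \subset U ->
  cherries U <= cherries (U :\: Z) + 3 * d ^+ 2 * #|Z|%:R.
Proof.
move=> hd sZ; set Y := U :\: Z.
have sY : Y \subset U by exact: subsetDl.
have split1 (F : V -> R) : \sum_(v in U) F v = \sum_(v in Z) F v + \sum_(v in Y) F v.
  by rewrite (big_setID Z) /= (setIidPr sZ).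
have mono (A B : {set V}) (F : V -> R) : A \subset B -> (forall v, 0 <= F v) ->
    \sum_(v in A) F v <= \sum_(v in B) F v.
  move=> sAB F0; rewrite [leRHS](big_setID A) /= (setIidPr sAB).
  by rewrite lerDl sumr_ge0.
have s0 (A : {set V}) (F : V -> R) : (forall v, 0 <= F v) -> 0 <= \sum_(v in A) F v.
  by move=> F0; apply: sumr_ge0.
have hP := paths_through_le hd sZ.
rewrite /cherries split1.
have h1 : \sum_(v in Z) \sum_(u in U) \sum_(w in U) (cherry e v (u, w))%:R
    <= #|Z|%:R * d ^+ 2 :> R.
  rewrite mulr_natl -sumr_const.
  apply: ler_sum => z /(subsetP sZ) zU.
  apply: le_trans (_ : \sum_(v in U) (e z v)%:R * d <= _).
    apply: ler_sum => v vU; rewrite /cherry /=; case: (e z v) => /=; last by rewrite big1 ?mul0r.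
    rewrite mul1r; apply: le_trans (hd z zU); apply: ler_sum => w _.
    by case: (e z w) => //=; rewrite lern1 leq_b1.
  rewrite -mulr_suml expr2 ler_wpM2r ?hd //.
  by apply: le_trans (hd z zU); apply: sumr_ge0.
have h2 : \sum_(v in Y) \sum_(u in Z) \sum_(w in U) (cherry e v (u, w))%:R
    <= #|Z|%:R * d ^+ 2 :> R.
  apply: le_trans hP; rewrite exchange_big /=; apply: ler_sum => z _.
  apply: le_trans (mono _ _ _ sY _) => [|v]; last exact: s0.
  apply: ler_sum => v _; apply: ler_sum => w _.
  rewrite /cherry /= (esym z v); case: (e v z) => //=; case: (e v w) => //=.
  by rewrite lern1 leq_b1.
have h3 : \sum_(v in Y) \sum_(u in Y) \sum_(w in Z) (cherry e v (u, w))%:R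
    <= #|Z|%:R * d ^+ 2 :> R.
  apply: le_trans hP; under eq_bigr do rewrite exchange_big.
  rewrite exchange_big /=; apply: ler_sum => z _.
  apply: le_trans (mono _ _ _ sY _) => [|v]; last by do 2?apply: s0 => ?.
  apply: ler_sum => v _; apply: le_trans (mono _ _ _ sY _) => [|u] //.
  apply: ler_sum => u _.
  rewrite /cherry /= (esym z v); case: (e v z) => //=; rewrite ?andbF //.
  by case: (e v u) => //=; rewrite lern1 leq_b1.
have -> : \sum_(v in Y) \sum_(u in U) \sum_(w in U) (cherry e v (u, w))%:R =
   \sum_(v in Y) \sum_(u in Z) \sum_(w in U) (cherry e v (u, w))%:R
   + (\sum_(v in Y) \sum_(u in Y) \sum_(w in Z) (cherry e v (u, w))%:R
   + \sum_(v in Y) \sum_(u in Y) \sum_(w in Y) (cherry e v (u, w))%:R) :> R.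
  rewrite -!big_split /=; apply: eq_bigr => v _.
  rewrite split1 -big_split /=; congr (_ + _); apply: eq_bigr => u _.
  exact: split1.
lra.
Qed.

(** A maximal packing [Z] of pieces with surplus [t / 3] per vertex has at most [3 * sigma / t]
    vertices. Outside it no blow-up of a cherry is left, so [tripartite] bounds the remaining
    cherries; [cherries_delete] accounts for those meeting [Z]. *)
Lemma few_cherries (sigma d : R) (U : {set V}) (g t h k : nat) :
    bounded_surplus e sigma -> (forall v, v \in U -> degree U v <= d) ->
    h = ((g + 2) * t + g + 1)%N -> k = ((h + 2) * t + h + 1)%N ->
    (0 < t)%N -> (t * 2 ^ k <= #|U|)%N ->
  cherries U <= #|U|%:R ^+ 3 / 2 ^+ g + 9 * d ^+ 2 * sigma / t%:R.
Proof.
move=> hs hd hE kE t0 tU.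
have [Z [sZ cZ maxZ]] := surplus_packing esym (t%:R / 3 : R) U.
have hZ := surplus_on_card hs cZ.
have tp : 0 < t%:R :> R by rewrite ltr0n.
(* The relation is confined to [U :\: Z] but counted over all of [U], so the lower bound on [#|U|]
   suffices however small [U :\: Z] is. *)
pose r v (p : V * V) := [&& v \in U :\: Z, p.1 \in U :\: Z, p.2 \in U :\: Z & cherry e v p].
have chE : cherries (U :\: Z) = (\sum_(v in U) #|[set p in setX U U | r v p]|)%:R.
  rewrite natr_sum /cherries [LHS]big_mkcond [RHS]big_mkcond; apply: eq_bigr => v _.
  rewrite -sum1dep_card natr_sum /r /= inE; case: (boolP (v \in U)) => vU; last by rewrite andbF.
  case: (boolP (v \in Z)) => vZ /=.
    by rewrite big_pred0 // => p; rewrite andbF.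
  rewrite pair_big_dep [LHS]big_mkcond [RHS]big_mkcond; apply: eq_bigr => -[u w] _ /=.
  rewrite !inE /=; case: (u \in U); case: (u \in Z); case: (w \in U); case: (w \in Z) => //=.
  by case: cherry.
have hlt : cherries (U :\: Z) <= #|U|%:R ^+ 3 / 2 ^+ g.
  rewrite ler_pdivlMr ?exprn_gt0 // leNgt; apply/negP => hgt.
  have dens : (#|U| ^ 3 <= 2 ^ g * \sum_(v in U) #|[set p in setX U U | r v p]|)%N.
    by rewrite -(ler_nat R) natrM !natrX mulrC -chE ltW.
  have [T1 [T2 [T3 [_ cT hT]]]] := tripartite hE kE t0 tU dens.
  have ch v u w : v \in T1 -> u \in T2 -> w \in T3 -> cherry e v (u, w).
    by move=> h1 h2 h3; have /and4P[] := hT v u w h1 h2 h3.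
  have := maxZ _ _ (blowup_surplus R esym eirr cT t0 ch).
  case: cT => c1 c2 c3.
  have [v0 v0T] : exists v, v \in T1 by apply/card_gt0P; rewrite c1.
  have [u0 u0T] : exists v, v \in T2 by apply/card_gt0P; rewrite c2.
  have [w0 w0T] : exists v, v \in T3 by apply/card_gt0P; rewrite c3.
  have -> : T1 :|: (T2 :|: T3) \subset U :\: Z.
    apply/subsetP => x; rewrite !inE => /or3P[x1|x2|x3].
    - by have /and4P[/=] := hT _ _ _ x1 u0T w0T; rewrite inE.
    - by have /and4P[/=] := hT _ _ _ v0T x2 w0T; rewrite !inE.
    - by have /and4P[/=] := hT _ _ _ v0T u0T x3; rewrite !inE.
  by move=> /(_ isT)/setP/(_ v0); rewrite !inE v0T.
have := cherries_delete hd sZ.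
have : 3 * d ^+ 2 * #|Z|%:R <= 9 * d ^+ 2 * sigma / t%:R.
  rewrite ler_pdivlMr //; have := sqr_ge0 d; nra.
lra.
Qed.

(** The cherries centred at [v] are the ordered nonadjacent pairs in its neighbourhood. If every
    neighbourhood of sufficient size had more than [eps * degree ^ 2] of them, convexity of the
    square would give twice the allowed number. *)
Lemma clique_like_neighbourhood (s a eps : R) (U : {set V}) :
    0 < s -> 0 < a -> 0 < eps -> #|U|%:R <= 4 * a * s -> s ^+ 2 / 8 <= arcs R e U U ->
    cherries U <= eps * s ^+ 3 / (2 ^+ 10 * a) ->
  exists S : {set V}, s / (64 * a) <= #|S|%:R /\
    \sum_(u in S) \sum_(w in S) ((u != w) && ~~ e u w)%:R <= eps * #|S|%:R ^+ 2.
Proof.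
move=> s0 a0 e0 hN hA hC.
pose S v := [set w in U | e v w].
have degE v : degree U v = #|S v|%:R.
  by rewrite /degree /S -sum1dep_card natr_sum [RHS]big_mkcondr /=; apply: eq_bigr => w _; case: (e v w).
pose nb v : R := \sum_(u in U) \sum_(w in U) (cherry e v (u, w))%:R.
have nbE v : nb v = \sum_(u in S v) \sum_(w in S v) ((u != w) && ~~ e u w)%:R.
  rewrite /nb [LHS]big_mkcond [RHS]big_mkcond; apply: eq_bigr => u _.
  rewrite /cherry inE /=; case: (u \in U) => //=; case: (e v u) => /=; last by rewrite big1.
  rewrite [LHS]big_mkcond [RHS]big_mkcond; apply: eq_bigr => w _; rewrite inE.
  by case: (w \in U) => //=; case: (e v w).
case: (pselect (exists v, [/\ v \in U, s / (64 * a) <= degree U v & nb v <= eps * degree U v ^+ 2])).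
  move=> [v [vU h1 h2]]; exists (S v); split.
  - by rewrite -degE.
  - by rewrite -nbE -degE.
move=> hn; exfalso.
(* A lower bound for the average degree in [U], namely [(s ^ 2 / 8) / (4 * a * s)]; degrees below
   [l / 2] are absorbed by the linear term in [key]. *)
pose l := s / (32 * a).
have l0 : 0 < l by rewrite divr_gt0 // mulr_gt0.
have lE : s / (64 * a) = l / 2 by rewrite /l; field; rewrite gt_eqF.
have key v : v \in U -> eps * degree U v ^+ 2 <= nb v + eps * (l / 2) * degree U v.
  move=> vU; have d0 : 0 <= degree U v by apply: sumr_ge0.
  have nb0 : 0 <= nb v by do 2!(apply: sumr_ge0 => ? _).
  case: (leP (l / 2) (degree U v)) => hd.
    case: (leP (nb v) (eps * degree U v ^+ 2)) => hnb.
      by exfalso; apply: hn; exists v; rewrite lE.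
    have : 0 <= eps * (l / 2) * degree U v by apply: mulr_ge0 => //; apply: ltW; apply: mulr_gt0 => //; lra.
    lra.
  have : eps * degree U v * degree U v <= eps * degree U v * (l / 2).
    by apply: ler_wpM2l; [apply: mulr_ge0 => //; exact: ltW | exact: ltW].
  rewrite expr2; lra.
have sumd : \sum_(v in U) degree U v = arcs R e U U by rewrite arcsE.
have h1 : eps * \sum_(v in U) degree U v ^+ 2 <= cherries U + eps * (l / 2) * arcs R e U U.
  rewrite -sumd !mulr_sumr /cherries -big_split; exact: ler_sum.
(* The tangent to the square at [l], summed over [U], takes the place of Cauchy-Schwarz. *)
have h2 : 2 * l * arcs R e U U - l ^+ 2 * #|U|%:R <= \sum_(v in U) degree U v ^+ 2.
  rewrite -sumd mulr_sumr mulr_natr -sumr_const -sumrB; apply: ler_sum => v _.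
  have := sqr_ge0 (degree U v - l); rewrite sqrrB; lra.
have h3 : l ^+ 2 * #|U|%:R <= l * arcs R e U U.
  rewrite expr2 -mulrA ler_pM2l //; apply: le_trans hA.
  apply: le_trans (_ : l * (4 * a * s) <= _); first by rewrite ler_pM2l.
  by rewrite /l le_eqVlt; apply/orP; left; apply/eqP; field; rewrite gt_eqF.
have h4 : eps * (l * arcs R e U U) <= eps * \sum_(v in U) degree U v ^+ 2.
  by rewrite ler_pM2l //; lra.
have h5 : eps * (l / 2) * (s ^+ 2 / 8) <= eps * (l / 2) * arcs R e U U.
  by rewrite ler_pM2l //; apply: mulr_gt0 => //; lra.
have h6 : eps * (l / 2) * (s ^+ 2 / 8) = 2 * (eps * s ^+ 3 / (2 ^+ 10 * a)).
  by rewrite /l; field; rewrite gt_eqF.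
have h7 : 0 < eps * s ^+ 3 / (2 ^+ 10 * a) by apply: divr_gt0; apply: mulr_gt0 => //; exact: exprn_gt0.
move: h5 h7 hC; rewrite h6; move: (eps * s ^+ 3 / (2 ^+ 10 * a)) => T h5 h7 hC.
lra.
Qed.
End FewCherries.

(** * Rounding by random rotations *)

Section RandomRotation.
Variables (R : rcfType) (V : finType).
Implicit Types (c s : V -> R) (y : {ffun V -> bool}).

(** With [c i] and [s i] the cosine and sine of an angle, this is the unit complex number whose
    argument is the sum of these angles with signs [y]. Its imaginary part, the sine of that sum, is
    a bounded substitute for the linear form itself. *)
Definition rotation c s y : R[i] :=
  \prod_i Complex (c i) (if y i then s i else - s i).

Definition rounding c s y : R := complex.Im (rotation c s y).

(** The sum over all signs factorises, and in each factor the two conjugates add up to [2 * c i]. *)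
Lemma sum_Re_rotation c s :
  \sum_(y : {ffun V -> bool}) complex.Re (rotation c s y) = 2 ^+ #|V| * \prod_i c i.
Proof.
have h : \sum_(y : {ffun V -> bool}) rotation c s y
    = real_complex R (2 ^+ #|V| * \prod_i c i).
  rewrite -(bigA_distr_bigA (fun i b => Complex (c i) (if b then s i else - s i))).
  rewrite -prodr_const -big_split rmorph_prod /=; apply: eq_bigr => i _.
  by rewrite big_bool /=; apply/eqP; rewrite eq_complex /= subrr eqxx andbT; apply/eqP; ring.
have -> : \sum_(y : {ffun V -> bool}) complex.Re (rotation c s y)
    = complex.Re (\sum_(y : {ffun V -> bool}) rotation c s y).
  by symmetry; apply: (big_morph (@complex.Re R)) => // -[? ?] [].
by rewrite h.
Qed.

Lemma rounding_norm c s y : (forall i, c i ^+ 2 + s i ^+ 2 = 1) ->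
  `|rounding c s y| <= 1.
Proof.
move=> h; have : complex.Re (rotation c s y) ^+ 2 + complex.Im (rotation c s y) ^+ 2 = 1.
  rewrite /rotation; elim/big_ind: _ => /=; first by rewrite expr1n expr0n addr0.
    by move=> [a b] [a' b'] /= h1 h2; rewrite -[RHS]mulr1 -{1}h1 -h2; ring.
  by move=> i _; case: (y i); rewrite ?sqrrN.
rewrite /rounding => h1; rewrite ler_norml.
have h2 := sqr_ge0 (complex.Re (rotation c s y)).
by apply/andP; split; nra.
Qed.

(* The product of two imaginary parts is half the real part of
   [a * conj b - a * b], and both products are again rotations up to scale. *)
Lemma rounding_correlation c s c' s' :
  \sum_(y : {ffun V -> bool}) rounding c s y * rounding c' s' y =
  2 ^+ #|V| * ((\prod_i (c i * c' i + s i * s' i)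
                - \prod_i (c i * c' i - s i * s' i)) / 2).
Proof.
have h y : rounding c s y * rounding c' s' y =
    (complex.Re (rotation (fun i => c i * c' i + s i * s' i) (fun i => s i * c' i - c i * s' i) y)
     - complex.Re (rotation (fun i => c i * c' i - s i * s' i) (fun i => s i * c' i + c i * s' i) y)) / 2.
  have -> : rotation (fun i => c i * c' i - s i * s' i) (fun i => s i * c' i + c i * s' i) y
      = rotation c s y * rotation c' s' y.
    rewrite /rotation -big_split /=; apply: eq_bigr => i _; apply/eqP.
    by rewrite eq_complex /=; case: (y i); apply/andP; split; apply/eqP; ring.
  have -> : rotation (fun i => c i * c' i + s i * s' i) (fun i => s i * c' i - c i * s' i) y
      = rotation c s y * rotation c' (fun i => - s' i) y.
    rewrite /rotation -big_split /=; apply: eq_bigr => i _; apply/eqP.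
    by rewrite eq_complex /=; case: (y i); apply/andP; split; apply/eqP; ring.
  have -> : rotation c' (fun i => - s' i) y = conjc (rotation c' s' y).
    rewrite /rotation; apply: (big_rec2 (fun a b => a = conjc b)) => [|i a b _ ->].
      by apply/eqP; rewrite eq_complex /= oppr0 !eqxx.
    by case: b => b1 b2; apply/eqP; rewrite eq_complex /=; case: (y i); apply/andP; split; apply/eqP; ring.
  rewrite /rounding; case: (rotation c s y) => a1 a2; case: (rotation c' s' y) => b1 b2 /=.
  by field.
rewrite (eq_bigr _ (fun y _ => h y)).
by rewrite -mulr_suml sumrB !sum_Re_rotation; ring.
Qed.
End RandomRotation.

(** * Differences of products *)

Section ProductBounds.
Variables (R : realFieldType) (V : finType) (p q : V -> R).
Hypotheses (q_ge0 : forall i, 0 <= q i) (q_le : forall i, q i <= p i).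

Lemma prod_diff_ge v :
  (p v - q v) * \prod_(i | i != v) p i <= \prod_i p i - \prod_i q i.
Proof.
rewrite [\prod_i p i](bigD1 v) //= [\prod_i q i](bigD1 v) //= mulrBl lerD2l lerN2.
by apply: ler_wpM2l => //; apply: ler_prod => i _; rewrite q_ge0 q_le.
Qed.

Lemma prod_diff_ge0 : 0 <= \prod_i p i - \prod_i q i.
Proof. by rewrite subr_ge0; apply: ler_prod => i _; rewrite q_ge0 q_le. Qed.

Lemma prod_diff_le : (forall i, p i <= 1) ->
  \prod_i p i - \prod_i q i <= \sum_i (p i - q i).
Proof.
move=> p1.
(* The telescoping induction has to carry the bounds that keep both partial products ordered in the
   unit interval. *)
have [//] : [/\ 0 <= \prod_i q i, \prod_i q i <= \prod_i p i, \prod_i p i <= 1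
  & \prod_i p i - \prod_i q i <= \sum_i (p i - q i)].
elim/big_rec3: _ => [|i S P Q _ [Q0 QP P1 hS]]; first by split; rewrite ?subrr.
have := q_ge0 i; have := q_le i; have := p1 i => h1 h2 h3.
by split; nra.
Qed.
End ProductBounds.

(** * Arcs between nonadjacent vertices *)

Section NonEdges.
Variables (V : finType) (e : rel V).
Hypotheses (esym : symmetric e) (eirr : irreflexive e).

Definition nonadj u v := (u != v) && ~~ e u v.

Lemma nonadjC u v : nonadj u v = nonadj v u.
Proof. by rewrite /nonadj eq_sym esym. Qed.

Definition out (F : {set V * V}) u := [set v | (u, v) \in F].
Definition inn (F : {set V * V}) v := [set u | (u, v) \in F].

(** The in-degree bound is looser than the out-degree bound so that, when [F] is small, the vertices
    saturated in either sense cannot exhaust [S]. *)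
Definition bounded_arcs (S : {set V}) (D : nat) (F : {set V * V}) :=
  [&& [forall p in F, [&& p.1 \in S, p.2 \in S & nonadj p.1 p.2]],
      [forall u, #|out F u| <= D]%N & [forall v, #|inn F v| <= 4 * D]%N].

Definition clique (K : {set V}) := [forall x in K, forall y in K, (x != y) ==> e x y].

Local Open Scope nat_scope.

Lemma card_out (F : {set V * V}) : #|F| = \sum_u #|out F u|.
Proof.
rewrite -sum1_card; under [RHS]eq_bigr do rewrite /out -sum1dep_card.
by rewrite pair_big_dep; apply: eq_bigl => -[u v].
Qed.

Lemma card_inn (F : {set V * V}) : #|F| = \sum_v #|inn F v|.
Proof.
rewrite -sum1_card; under [RHS]eq_bigr do rewrite /inn -sum1dep_card.
rewrite (exchange_big_dep xpredT) //= pair_big_dep; apply: eq_bigl => -[u v] //.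
Qed.

(* A maximal clique [K] of [W] covers [W] by the closed non-neighbourhoods of its members. *)
Lemma greedy_clique (W : {set V}) (F : {set V * V}) (D : nat) :
    (forall u, u \in W -> #|out F u| < D) ->
    (forall u v, u \in W -> v \in W -> nonadj u v -> (u, v) \in F) ->
  exists2 K, clique K & #|W| <= D * #|K|.
Proof.
move=> hD hF.
pose P (K : {set V}) := clique K && (K \subset W).
have P0 : P set0 by rewrite /P sub0set andbT; apply/forall_inP => x; rewrite inE.
case: (@arg_maxnP _ set0 P (fun K => #|K|) P0) => K /andP[cK sK] maxK.
exists K => //.
have cov : W \subset \bigcup_(x in K) (x |: out F x).
  apply/subsetP => w wW; apply/bigcupP; apply/exists_inP.
  rewrite -[X in is_true X]negbK; apply/negP => /exists_inPn hn.
  have wK : w \notin K by apply/negP => wK; have := hn w wK; rewrite !inE eqxx.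
  have adjw x : x \in K -> e x w.
    move=> xK; have := hn x xK; rewrite !inE negb_or => /andP[wx].
    case: (boolP (e x w)) => // nxw /negP[]; apply: hF => //; first exact: (subsetP sK).
    by rewrite /nonadj eq_sym wx.
  have : #|w |: K| <= #|K|.
    apply: maxK; rewrite /P subUset sub1set wW sK !andbT.
    apply/forall_inP => x; rewrite !inE => hx; apply/forall_inP => y; rewrite !inE => hy.
    apply/implyP => xy; case/orP: hx hy => [/eqP xw|xK] /orP[/eqP yw|yK].
    - by rewrite xw yw eqxx in xy.
    - by rewrite xw esym adjw.
    - by rewrite yw adjw.
    - by move/forall_inP: cK => /(_ x xK)/forall_inP/(_ y yK)/implyP; apply.
  by rewrite cardsU1 wK ltnn.
apply: leq_trans (subset_leq_card cov) _.
apply: leq_trans (_ : \sum_(x in K) #|x |: out F x| <= _).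
  elim/big_rec2: _ => [|x m A _ hA]; first by rewrite cards0.
  by apply: leq_trans (leq_card_setU _ _) _; rewrite leq_add2l.
rewrite mulnC -sum_nat_const; apply: leq_sum => x /(subsetP sK) xW.
by apply: leq_trans (hD x xW); rewrite cardsU1; case: (_ \notin _).
Qed.

(** Take [F] of maximum cardinality. Between two unsaturated vertices every nonadjacent pair is
    already an arc, so [greedy_clique] applies to the set [W] of unsaturated vertices. *)
Lemma arcs_or_clique (S : {set V}) (D : nat) : 0 < D ->
  exists2 F, bounded_arcs S D F &
    #|S| * D <= 2 * #|F| \/ exists2 K, clique K & #|S| <= 4 * D * #|K|.
Proof.
move=> D0.
have P0 : bounded_arcs S D set0.
  apply/and3P; split.
  - by apply/forall_inP => p; rewrite inE.
  - by apply/forallP => u; rewrite (_ : out _ _ = set0) ?cards0 //; apply/setP => v; rewrite !inE.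
  - by apply/forallP => u; rewrite (_ : inn _ _ = set0) ?cards0 //; apply/setP => v; rewrite !inE.
case: (@arg_maxnP _ set0 (bounded_arcs S D) (fun F => #|F|) P0) => F bF maxF.
exists F => //; case: (leqP (#|S| * D) (2 * #|F|)) => [|small]; first by left.
right; have /and3P[/forall_inP hF /forallP hout /forallP hin] := bF.
pose A := [set u in S | #|out F u| == D].
pose X := [set v in S | #|inn F v| == 4 * D].
pose W := S :\: (A :|: X).
have hA : #|A| * D <= #|F|.
  rewrite card_out -sum_nat_const [leqLHS]big_mkcond; apply: leq_sum => u _.
  by rewrite inE; case: ifP => // /andP[_ /eqP->].
have hX : #|X| * (4 * D) <= #|F|.
  rewrite card_inn -sum_nat_const [leqLHS]big_mkcond; apply: leq_sum => u _.
  by rewrite inE; case: ifP => // /andP[_ /eqP->].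
have hW : #|S| <= #|W| + (#|A| + #|X|).
  rewrite -(cardsID (A :|: X) S) addnC leq_add2l.
  by apply: leq_trans (subset_leq_card (subsetIr _ _)) (leq_card_setU _ _).
have [|u v uW vW nuv|K cK hK] := @greedy_clique W F D.
- move=> u; rewrite !inE negb_or => /andP[/andP[hu _] uS].
  by rewrite ltn_neqAle hout andbT; move: hu; rewrite uS.
- rewrite -[X in is_true X]negbK; apply/negP => nF.
  move: uW vW; rewrite !inE !negb_or => /andP[/andP[hu _] uS] /andP[/andP[_ hv] vS].
  rewrite uS /= in hu; rewrite vS /= in hv.
  have : #|(u, v) |: F| <= #|F|.
    apply: maxF; apply/and3P; split.
    + apply/forall_inP => p; rewrite inE => /orP[|/hF //].
      by rewrite inE => /eqP-> /=; rewrite uS vS.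
    + apply/forallP => x; have [->|xu] := eqVneq x u.
        apply: leq_trans (_ : #|v |: out F u| <= _).
          by apply: subset_leq_card; apply/subsetP => y; rewrite !inE xpair_eqE eqxx.
        rewrite cardsU1; have := hout u; rewrite leq_eqVlt (negbTE hu) /= => h.
        by apply: leq_trans h; case: (_ \notin _).
      apply: leq_trans (hout x); apply: subset_leq_card; apply/subsetP => y.
      by rewrite !inE xpair_eqE (negbTE xu).
    + apply/forallP => x; have [->|xv] := eqVneq x v.
        apply: leq_trans (_ : #|u |: inn F v| <= _).
          by apply: subset_leq_card; apply/subsetP => y; rewrite !inE xpair_eqE eqxx andbT.
        rewrite cardsU1; have := hin v; rewrite leq_eqVlt (negbTE hv) /= => h.
        by apply: leq_trans h; case: (_ \notin _).
      apply: leq_trans (hin x); apply: subset_leq_card; apply/subsetP => y.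
      by rewrite !inE xpair_eqE (negbTE xv) andbF.
  by rewrite cardsU1 nF ltnn.
exists K => //.
(* Saturated vertices make up less than [1/2 + 1/8] of [S], so [W] keeps more than a quarter. *)
have h1 : 2 * #|A| < #|S| by rewrite -(ltn_pmul2r D0); apply: leq_ltn_trans small; lia.
have h2 : 8 * #|X| < #|S| by rewrite -(ltn_pmul2r D0); apply: leq_ltn_trans small; lia.
by rewrite -mulnA; apply: leq_trans (_ : 4 * #|W| <= _); lia.
Qed.
End NonEdges.

(** * The form on vectors of mean zero *)

Section CentredForm.
Variables (R : realFieldType) (V : finType) (e : rel V).
Hypotheses (esym : symmetric e) (eirr : irreflexive e).

(** The degree in the complement graph, not a number of common neighbours. *)
Definition codegree (S : {set V}) u : R := \sum_(w in S) (nonadj e u w)%:R.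

(** Halving keeps the entries in [[-1, 1]] after the mean has been subtracted. *)
Definition centred (S : {set V}) (z : V -> R) u : R :=
  if u \in S then (z u - (\sum_(w in S) z w) / #|S|%:R) / 2 else 0.

Lemma centred_norm S z : (forall u, `|z u| <= 1) -> forall u, `|centred S z u| <= 1.
Proof.
move=> hz u; rewrite /centred; case: ifP => [uS|_]; last by rewrite normr0.
have n0 : 0 < #|S|%:R :> R by rewrite ltr0n; apply/card_gt0P; exists u.
have h : `|\sum_(w in S) z w| <= #|S|%:R.
  by apply: le_trans (ler_norm_sum _ _ _) _; rewrite -sumr_const; apply: ler_sum.
have h2 : `|(\sum_(w in S) z w) / #|S|%:R| <= 1.
  by rewrite normrM normfV (gtr0_norm n0) ler_pdivrMr // mul1r.
have h1 := hz u; move: h1 h2; rewrite !ler_norml => /andP[h1 h2] /andP[h3 h4].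
by apply/andP; split; lra.
Qed.

(** On [S] the adjacency matrix is the all-ones matrix minus the identity minus [nonadj]. The first
    vanishes on vectors of mean zero and the second only helps. Expanding the third around the mean
    [m] gives the [codegree] term and a term in [m ^ 2] of favourable sign. *)
Lemma qform_centred (S : {set V}) (z : V -> R) : (0 < #|S|)%N ->
  4 * qform e (centred S z) <=
    - (\sum_(u in S) \sum_(w in S) (nonadj e u w)%:R * (z u * z w))
    + 2 / #|S|%:R * \sum_(u in S) \sum_(w in S) codegree S u * (z u * z w).
Proof.
move=> S0; have n0 : 0 < #|S|%:R :> R by rewrite ltr0n.
set Z := \sum_(w in S) z w; set n : R := #|S|%:R in n0 *.
pose m := Z / n; pose x u := z u - m.
pose b u w : R := (nonadj e u w)%:R.
have x0 : \sum_(u in S) x u = 0.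
  by rewrite sumrB sumr_const -/Z /m -mulr_natl mulrCA divff ?gt_eqF // mulr1 subrr.
have qE : 4 * qform e (centred S z) = \sum_(u in S) \sum_(w in S) (e u w)%:R * (x u * x w).
  rewrite /qform /bform mulr_sumr [RHS]big_mkcond; apply: eq_bigr => u _.
  rewrite /centred; case: (u \in S); last first.
    by rewrite big1 ?mulr0 // => w _; rewrite mulr0 mul0r.
  rewrite mulr_sumr [RHS]big_mkcond; apply: eq_bigr => w _.
  by case: (w \in S); rewrite ?mulr0 // -/Z -/n -/m /x; field.
have eE u w : (e u w)%:R = 1 - (u == w)%:R - b u w :> R.
  rewrite /b /nonadj; case: eqP => [->|_] /=; first by rewrite eirr subrr subr0.
  by case: (e u w); rewrite subr0 ?subr0 ?subrr.
have -> : \sum_(u in S) \sum_(w in S) (nonadj e u w)%:R * (z u * z w) =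
   \sum_(u in S) \sum_(w in S) b u w * (x u * x w)
   + 2 * m * \sum_(u in S) codegree S u * z u - m ^+ 2 * \sum_(u in S) codegree S u.
  have -> : 2 * m * \sum_(u in S) codegree S u * z u =
     m * (\sum_(u in S) \sum_(w in S) b u w * z u) + m * (\sum_(u in S) \sum_(w in S) b u w * z w).
    have -> : \sum_(u in S) \sum_(w in S) b u w * z w = \sum_(u in S) \sum_(w in S) b u w * z u.
      rewrite exchange_big; apply: eq_bigr => u _; apply: eq_bigr => w _.
      by rewrite /b nonadjC.
    have -> : \sum_(u in S) \sum_(w in S) b u w * z u = \sum_(u in S) codegree S u * z u.
      by apply: eq_bigr => u _; rewrite mulr_suml.
    ring.
  rewrite !mulr_sumr -!big_split -sumrB /=; apply: eq_bigr => u _.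
  rewrite /codegree !mulr_sumr -!big_split -sumrB /=; apply: eq_bigr => w _.
  by rewrite /x /b; ring.
have -> : 2 / n * \sum_(u in S) \sum_(w in S) codegree S u * (z u * z w)
    = 2 * m * \sum_(u in S) codegree S u * z u.
  under eq_bigr => u _.
    under eq_bigr do rewrite mulrA.
    rewrite -mulr_sumr -/Z.
    over.
  by rewrite -mulr_suml /m; ring.
have -> : 4 * qform e (centred S z) = - \sum_(u in S) x u ^+ 2
   - \sum_(u in S) \sum_(w in S) b u w * (x u * x w).
  have -> : - \sum_(u in S) x u ^+ 2 = (\sum_(u in S) x u) * (\sum_(u in S) x u)
      - \sum_(u in S) \sum_(w in S) (u == w)%:R * (x u * x w).
    rewrite x0 mul0r sub0r; congr (- _); apply: eq_bigr => u uS.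
    rewrite (bigD1 u) //= eqxx mul1r big1 ?addr0 // => w /andP[_ wu].
    by rewrite eq_sym (negbTE wu) mul0r.
  rewrite qE mulr_suml -!sumrB; apply: eq_bigr => u _.
  rewrite mulr_sumr -!sumrB; apply: eq_bigr => w _.
  by rewrite eE; ring.
have h1 : 0 <= \sum_(u in S) x u ^+ 2 by apply: sumr_ge0 => u _; exact: sqr_ge0.
have h2 : 0 <= m ^+ 2 * \sum_(u in S) codegree S u.
  by apply: mulr_ge0; rewrite ?sqr_ge0 //; do 2!(apply: sumr_ge0 => ? _).
lra.
Qed.
End CentredForm.

Lemma bernoulli (R : realFieldType) (x : R) n : 0 <= x <= 1 -> 1 - n%:R * x <= (1 - x) ^+ n.
Proof.
move=> /andP[x0 x1]; elim: n => [|n IH]; first by rewrite mul0r subr0 expr0.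
rewrite exprS -natr1; have : (1 - x) * (1 - n%:R * x) <= (1 - x) * (1 - x) ^+ n.
  by rewrite ler_wpM2l // subr_ge0.
have : 0 <= n%:R * x * x by rewrite !mulr_ge0.
lra.
Qed.

(** * Correlations of the rounded signs *)

Section Correlations.
Variables (R : realFieldType) (V : finType) (F : {set V * V}) (D : nat) (s c : R).
Hypotheses (s0 : 0 <= s) (sc : s <= c) (cs1 : c ^+ 2 + s ^+ 2 = 1) (Ds : D%:R * s ^+ 2 <= 2^-1).
Hypotheses (Firr : forall u, (u, u) \notin F) (Fout : forall u, (#|out F u| <= D)%N).

(** The large angle comes from the 3-4-5 triangle. All angles have sine at most cosine, so the
    cosine of a sum of two of them is nonnegative, as the product bounds require. *)
Definition cos_coef u i : R := if i == u then 4 / 5 else if (u, i) \in F then c else 1.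
Definition sin_coef u i : R := if i == u then 3 / 5 else if (u, i) \in F then s else 0.

Lemma coef_norm u i : cos_coef u i ^+ 2 + sin_coef u i ^+ 2 = 1.
Proof.
rewrite /cos_coef /sin_coef; case: eqP => _; first by field.
by case: ifP => _ //; rewrite expr1n expr0n addr0.
Qed.

Lemma c_le1 : c <= 1.
Proof.
rewrite leNgt; apply/negP => c1; have : 1 < c ^+ 2 by rewrite exprn_egt1.
have := sqr_ge0 s; have := cs1; lra.
Qed.

Lemma sin_coef_bounds u i : 0 <= sin_coef u i <= cos_coef u i.
Proof.
rewrite /cos_coef /sin_coef; case: eqP => _; first by lra.
by case: ifP => _; rewrite ?s0 ?sc ?lexx ?ler01.
Qed.

Lemma cos_coef_le1 u i : cos_coef u i <= 1.
Proof.
rewrite /cos_coef; case: eqP => _; first by lra.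
by case: ifP => _ //; exact: c_le1.
Qed.

(** Cosines of the difference and of the sum of the two angles at [i]. By [rounding_correlation],
    [correlation] is the expected product of the roundings of [u] and [w]. *)
Definition cos_sub u w i := cos_coef u i * cos_coef w i + sin_coef u i * sin_coef w i.
Definition cos_add u w i := cos_coef u i * cos_coef w i - sin_coef u i * sin_coef w i.
Definition correlation u w := (\prod_i cos_sub u w i - \prod_i cos_add u w i) / 2.

Lemma cos_add_ge0 u w i : 0 <= cos_add u w i.
Proof.
have /andP[h1 h2] := sin_coef_bounds u i; have /andP[h3 h4] := sin_coef_bounds w i.
by rewrite /cos_add subr_ge0; apply: ler_pM.
Qed.

Lemma cos_add_le u w i : cos_add u w i <= cos_sub u w i.
Proof.
have /andP[h1 h2] := sin_coef_bounds u i; have /andP[h3 h4] := sin_coef_bounds w i.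
rewrite /cos_add /cos_sub; have : 0 <= sin_coef u i * sin_coef w i by exact: mulr_ge0.
lra.
Qed.

Lemma cos_sub_le1 u w i : cos_sub u w i <= 1.
Proof.
have h1 := coef_norm u i; have h2 := coef_norm w i.
have := sqr_ge0 (cos_coef u i - cos_coef w i); have := sqr_ge0 (sin_coef u i - sin_coef w i).
rewrite /cos_sub !sqrrB; lra.
Qed.

Lemma correlation_ge0 u w : 0 <= correlation u w.
Proof.
by rewrite divr_ge0 //; apply: prod_diff_ge0 => i; rewrite ?cos_add_ge0 ?cos_add_le.
Qed.

Lemma correlation_le u w : correlation u w <= \sum_i sin_coef u i * sin_coef w i.
Proof.
rewrite /correlation ler_pdivrMr // mulr_suml.
apply: le_trans (prod_diff_le (cos_add_ge0 u w) (cos_add_le u w) (cos_sub_le1 u w)) _.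
by apply: ler_sum => i _; rewrite /cos_add /cos_sub; lra.
Qed.

Lemma prod_cos_coef u : \prod_(i | i != u) cos_coef u i = c ^+ #|out F u|.
Proof.
rewrite -prodr_const [LHS]big_mkcond [RHS]big_mkcond; apply: eq_bigr => i _.
by rewrite inE /cos_coef; case: eqP => [->|_] /=; rewrite ?(negbTE (Firr u)).
Qed.

(** Only the factor at [v] is compared: there the large angle of [v] meets the small angle of [u], a
    gain of [2 * (3 / 5) * s], and the other factors have product at least [2 / 5]. *)
Lemma correlation_arc u v : (u, v) \in F -> s / 5 <= correlation u v.
Proof.
move=> uvF; have uv : u != v by apply/eqP => uv; rewrite uv (negbTE (Firr v)) in uvF.
rewrite /correlation ler_pdivlMr //.
apply: le_trans (prod_diff_ge (cos_add_ge0 u v) (cos_add_le u v) v).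
have cc0 w i : 0 <= cos_coef w i by have /andP[] := sin_coef_bounds w i; exact: le_trans.
have h1 : 2 / 5 <= \prod_(i | i != v) cos_sub u v i.
  apply: le_trans (_ : \prod_(i | i != v) (cos_coef u i * cos_coef v i) <= _); last first.
    apply: ler_prod => i _; rewrite mulr_ge0 //= /cos_sub lerDl mulr_ge0 //.
      by have /andP[] := sin_coef_bounds u i.
    by have /andP[] := sin_coef_bounds v i.
  rewrite big_split /= prod_cos_coef.
  (* The factor 4/5 is the angle of [u] itself. The small angles of [u] and [v] leave
     [c ^ (2 * D) = (1 - s ^ 2) ^ D], at least 1/2 by Bernoulli's inequality. *)
  have h2 : 4 / 5 * c ^+ #|out F u| <= \prod_(i | i != v) cos_coef u i.
    rewrite -prod_cos_coef.
    have -> : 4 / 5 * \prod_(i | i != u) cos_coef u i = \prod_i cos_coef u i.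
      by rewrite [RHS](bigD1 u) //= {2}/cos_coef eqxx.
    rewrite [leLHS](bigD1 v) //= ler_piMl ?cos_coef_le1 //.
    by apply: prodr_ge0.
  have c0 : 0 <= c by exact: le_trans sc.
  have c1 := c_le1.
  have h3 w : c ^+ D <= c ^+ #|out F w| by apply: ler_wiXn2l.
  have h4 : 2^-1 <= c ^+ D * c ^+ D.
    rewrite -exprMn -expr2 (_ : c ^+ 2 = 1 - s ^+ 2); last by have := cs1; lra.
    apply: le_trans (bernoulli D _); first by have := Ds; lra.
    by rewrite sqr_ge0 /=; have := sqr_ge0 c; have := cs1; lra.
  have h5 : c ^+ D * c ^+ D <= c ^+ #|out F u| * c ^+ #|out F v|.
    by apply: ler_pM; rewrite ?exprn_ge0.
  apply: le_trans (_ : (4 / 5 * c ^+ #|out F u|) * c ^+ #|out F v| <= _); last first.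
    by rewrite ler_wpM2r ?exprn_ge0.
  by rewrite -mulrA; lra.
have -> : cos_sub u v v - cos_add u v v = 6 / 5 * s.
  by rewrite /cos_sub /cos_add /sin_coef eqxx eq_sym (negbTE uv) uvF; lra.
have := s0; nra.
Qed.
End Correlations.

(** * Discrepancy from many nonadjacent arcs *)

Section Discrepancy.
Variables (R : rcfType) (V : finType) (e : rel V).
Hypotheses (esym : symmetric e) (eirr : irreflexive e).

(* Each [u] in [S] is rounded to the imaginary part of a product of random
   rotations: a large angle for its own sign and a small one for the sign of
   each out-neighbour. Pairwise correlations are then nonnegative, at least of
   order [1 / k] on arcs, and bounded by those of the linear form
   [y u + (\sum_(v in out F u) y v) / k]. *)
Lemma nonadj_discrepancy (S : {set V}) (F : {set V * V}) (k : nat) (sigma Delta : R) :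
    (0 < k)%N -> (0 < #|S|)%N -> bounded_surplus e sigma ->
    bounded_arcs e S (2 * k ^ 2) F -> (#|S| * (2 * k ^ 2) <= 2 * #|F|)%N ->
    (forall u, u \in S -> codegree R e S u <= Delta) ->
  #|S|%:R * k%:R / 10 <= 4 * sigma + 50 * Delta * k%:R ^+ 2.
Proof.
move=> k0 S0 hs /and3P[/forall_inP hF /forallP hout /forallP hin] hcard hD.
have k1 : 1 <= k%:R :> R by rewrite ler1n.
have kp : 0 < k%:R :> R by rewrite ltr0n.
have n0 : 0 < #|S|%:R :> R by rewrite ltr0n.
(* This sine gives [D * s ^ 2 = 1 / 2] for [D = 2 * k ^ 2], the largest value that [correlation_arc]
   allows. *)
pose s : R := (2 * k%:R)^-1; pose c : R := Num.sqrt (1 - s ^+ 2).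
have s0 : 0 < s by rewrite invr_gt0 mulr_gt0.
have sk : s * k%:R = 2^-1 by rewrite /s; field; rewrite gt_eqF.
have s12 : s <= 2^-1 by rewrite -sk ler_peMr // ltW.
have s2 : s ^+ 2 <= 4^-1 by rewrite expr2; nra.
have cs1 : c ^+ 2 + s ^+ 2 = 1 by rewrite sqr_sqrtr ?subrK // subr_ge0; lra.
have c0 : 0 <= c by exact: sqrtr_ge0.
have sc : s <= c.
  by rewrite -(@ler_pXn2r _ 2) ?nnegrE ?(ltW s0) //; lra.
have DsE : (2 * k ^ 2)%:R * s ^+ 2 = 2^-1 :> R.
  by rewrite natrM natrX -mulrA -exprMn mulrC [k%:R * s]mulrC sk; field.
have Ds : (2 * k ^ 2)%:R * s ^+ 2 <= 2^-1 by rewrite DsE.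
have Firr u : (u, u) \notin F.
  by apply/negP => /hF/and3P[_ _]; rewrite /nonadj eqxx.
pose co := cos_coef F c; pose si := sin_coef F s; pose corr := correlation F s c.
have corr0 u w : 0 <= corr u w := correlation_ge0 F (ltW s0) sc u w.
pose z (y : {ffun V -> bool}) u := rounding (co u) (si u) y.
have zE u w : \sum_y z y u * z y w = 2 ^+ #|V| * corr u w by exact: rounding_correlation.
have p0 : 0 < 2 ^+ #|V| :> R by rewrite exprn_gt0.
(* The inequality of [qform_centred] averaged over all sign vectors [y]. *)
have h1 : - (4 * sigma) <= - (\sum_(u in S) \sum_(w in S) (nonadj e u w)%:R * corr u w)
    + 2 / #|S|%:R * \sum_(u in S) \sum_(w in S) codegree R e S u * corr u w.
  rewrite -(ler_pM2l p0) mulrDr [_ * - (\sum_(u in S) _)]mulrN.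
  have -> : 2 ^+ #|V| * (\sum_(u in S) \sum_(w in S) (nonadj e u w)%:R * corr u w)
     = \sum_y \sum_(u in S) \sum_(w in S) (nonadj e u w)%:R * (z y u * z y w).
    rewrite [RHS]exchange_big mulr_sumr; apply: eq_bigr => u _ /=.
    rewrite [RHS]exchange_big mulr_sumr; apply: eq_bigr => w _ /=.
    by rewrite -mulr_sumr zE mulrCA.
  have -> : 2 ^+ #|V| * (2 / #|S|%:R * \sum_(u in S) \sum_(w in S) codegree R e S u * corr u w)
     = \sum_y 2 / #|S|%:R * \sum_(u in S) \sum_(w in S) codegree R e S u * (z y u * z y w).
    rewrite -mulr_sumr mulrCA; congr (_ * _).
    rewrite [RHS]exchange_big mulr_sumr; apply: eq_bigr => u _ /=.
    rewrite [RHS]exchange_big mulr_sumr; apply: eq_bigr => w _ /=.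
    by rewrite -mulr_sumr zE mulrCA.
  rewrite -sumrN -big_split /=.
  have -> : 2 ^+ #|V| * - (4 * sigma) = \sum_(y : {ffun V -> bool}) - (4 * sigma).
    by rewrite sumr_const card_ffun card_bool -[RHS]mulr_natl natrX.
  apply: ler_sum => y _; apply: le_trans (qform_centred esym eirr (z y) S0).
  rewrite -mulrN ler_pM2l //; apply: hs; apply: centred_norm => u.
  by apply: rounding_norm => i; exact: coef_norm.
have h2 : #|F|%:R * (s / 5) <= \sum_(u in S) \sum_(w in S) (nonadj e u w)%:R * corr u w.
  rewrite pair_big_dep mulr_natl -sumr_const /= [leLHS]big_mkcond [leRHS]big_mkcond.
  apply: ler_sum => -[u w] _ /=; case: ifP => [uwF|_].
    have /and3P[/= -> -> ->] := hF _ uwF; rewrite mul1r.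
    exact: (correlation_arc (ltW s0) sc cs1 Ds Firr hout uwF).
  by case: ifP => // _; rewrite mulr_ge0.
have h3 : \sum_(u in S) \sum_(w in S) corr u w <= #|S|%:R * (25 * k%:R ^+ 2).
  apply: le_trans (_ : \sum_(u in S) \sum_(w in S) \sum_i si u i * si w i <= _).
    apply: ler_sum => u _; apply: ler_sum => w _.
    exact: (correlation_le F (ltW s0) sc cs1).
  have -> : \sum_(u in S) \sum_(w in S) \sum_i si u i * si w i
      = \sum_i (\sum_(u in S) si u i) ^+ 2.
    under eq_bigr do rewrite exchange_big.
    rewrite exchange_big; apply: eq_bigr => i _ /=; rewrite expr2 mulr_suml.
    by apply: eq_bigr => u _; rewrite mulr_sumr.
  rewrite mulr_natl -sumr_const [leRHS]big_mkcond; apply: ler_sum => i _.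
  case: ifP => iS; last first.
    rewrite big1 ?expr0n // => u uS; rewrite /si /sin_coef.
    case: eqP => [iu|_]; first by rewrite iu uS in iS.
    by case: ifP => // /hF/and3P[_ /=]; rewrite iS.
  (* Coordinate [i] is used by [i] itself and by its in-neighbours, so the in-degree bound makes
     this column sum at most [5 * k]. *)
  have h : \sum_(u in S) si u i <= 3 / 5 + (4 * (2 * k ^ 2))%:R * s.
    rewrite (bigD1 i) //= {1}/si /sin_coef eqxx lerD2l.
    apply: le_trans (_ : #|inn F i|%:R * s <= _); last by rewrite ler_pM2r // ler_nat.
    rewrite mulr_natl -sumr_const [leLHS]big_mkcond [leRHS]big_mkcond.
    apply: ler_sum => u _; rewrite /si /sin_coef inE.
    case: (boolP (u \in S)) => uS; case: (eqVneq i u) => [->|iu] /=;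
      rewrite ?(negbTE (Firr u)) //.
    by case: ifP => // _; exact: ltW.
  have hk : (4 * (2 * k ^ 2))%:R * s = 4 * k%:R :> R.
    by rewrite !natrM; have : k%:R * (s * k%:R) = k%:R * 2^-1 :> R by [rewrite sk]; lra.
  have h0 : 0 <= \sum_(u in S) si u i.
    by apply: sumr_ge0 => u _; have /andP[] := sin_coef_bounds F (ltW s0) sc u i.
  have : \sum_(u in S) si u i <= 5 * k%:R by lra.
  by move=> h5; rewrite expr2; nra.
have h4 : \sum_(u in S) \sum_(w in S) codegree R e S u * corr u w
    <= Delta * (#|S|%:R * (25 * k%:R ^+ 2)).
  have D0 : 0 <= Delta.
    have /card_gt0P[u uS] := S0; apply: le_trans (hD u uS); exact: sumr_ge0.
  apply: le_trans (_ : Delta * \sum_(u in S) \sum_(w in S) corr u w <= _); last by rewrite ler_wpM2l.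
  rewrite mulr_sumr; apply: ler_sum => u uS; rewrite mulr_sumr; apply: ler_sum => w _.
  by rewrite ler_wpM2r // hD.
have h5 : 2 / #|S|%:R * \sum_(u in S) \sum_(w in S) codegree R e S u * corr u w
    <= 50 * Delta * k%:R ^+ 2.
  apply: le_trans (_ : 2 / #|S|%:R * (Delta * (#|S|%:R * (25 * k%:R ^+ 2))) <= _).
    by rewrite ler_pM2l // divr_gt0.
  by rewrite le_eqVlt; apply/orP; left; apply/eqP; field; rewrite gt_eqF.
have h6 : #|S|%:R * k%:R / 10 <= #|F|%:R * (s / 5).
  have : #|S|%:R * k%:R ^+ 2 <= #|F|%:R :> R.
    by rewrite -natrX -natrM ler_nat; move: hcard; rewrite mulnCA leq_pmul2l.
  move=> h; have := ler_wpM2r (ltW s0) h.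
  rewrite (_ : #|S|%:R * k%:R ^+ 2 * s = #|S|%:R * k%:R * (s * k%:R)); last by ring.
  rewrite sk; lra.
lra.
Qed.
End Discrepancy.

(** * Cuts *)

Section CutsOfGraphs.
Variables (R : realFieldType) (G : sgraph).
Implicit Types (A : {set G}) (p : G * G).

Lemma set2_eqP (T : finType) (a b x y : T) : x != y -> [set a; b] = [set x; y] ->
  (a = x /\ b = y) \/ (a = y /\ b = x).
Proof.
move=> xy E.
have /set2P ha : a \in [set x; y] by rewrite -E set21.
have /set2P hb : b \in [set x; y] by rewrite -E set22.
have hx : x \in [set a; b] by rewrite E set21.
have hy : y \in [set a; b] by rewrite E set22.
case: ha hb hx hy => -> [] -> ; rewrite !inE ?orbb; auto.
  by move=> _; rewrite eq_sym (negbTE xy).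
by rewrite (negbTE xy).
Qed.

Lemma adj_neq (x y : G) : adj x y -> x != y.
Proof. by apply: contraTneq => ->; rewrite adj_irrefl. Qed.

Lemma arcs_natE (X Y : {set G}) : arcs R (@adj G) X Y =
  #|[set p | [&& p.1 \in X, p.2 \in Y & adj p.1 p.2]]|%:R.
Proof.
rewrite arcsE -sum1dep_card natr_sum pair_big_dep /= [LHS]big_mkcond [RHS]big_mkcond.
apply: eq_bigr => -[u v] _ /=; rewrite andbA; case: (_ && _) => //=.
by case: (adj u v).
Qed.

Lemma arcsT_edges : arcs R (@adj G) setT setT = 2 * #|edges G|%:R.
Proof.
rewrite arcs_natE -natrM; congr _%:R.
rewrite -sum1_card (partition_big (fun p => [set p.1; p.2]) (mem (edges G))) /=; last first.
  move=> [x y]; rewrite !inE /= => xy.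
  by apply/existsP; exists x; apply/existsP; exists y; rewrite xy eqxx.
rewrite mulnC -sum_nat_const; apply: eq_bigr => f.
rewrite inE => /existsP[x /existsP[y /andP[xy /eqP->]]].
have nxy := adj_neq xy.
rewrite (eq_bigl (mem [set (x, y); (y, x)])) ?sum1_card ?cards2.
  by rewrite xpair_eqE negb_and nxy.
move=> [a b]; rewrite !inE /= !xpair_eqE; apply/andP/orP.
  by move=> [_ /eqP/(set2_eqP nxy)[] [-> ->]]; rewrite !eqxx; auto.
case=> /andP[/eqP-> /eqP->]; first by rewrite xy eqxx.
by rewrite adj_sym xy setUC eqxx.
Qed.

Lemma arcs_cut A : arcs R (@adj G) A (~: A) = (cut_size A)%:R.
Proof.
rewrite arcs_natE; congr _%:R; rewrite /cut_size.
have -> : cut_edges A = (fun p => [set p.1; p.2]) @: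
    [set p | [&& p.1 \in A, p.2 \in ~: A & adj p.1 p.2]].
  apply/setP => f; apply/idP/imsetP.
    rewrite inE => /andP[fE /exists_inP[x xA /exists_inP[y yA /eqP fxy]]].
    exists (x, y); rewrite // inE /= xA yA /=.
    move: fE; rewrite inE => /existsP[u /existsP[v /andP[uv /eqP]]].
    rewrite fxy => /(set2_eqP (adj_neq uv))[] [-> ->] //.
    by rewrite adj_sym.
  move=> [[x y]]; rewrite inE /= => /and3P[xA yA xy] ->.
  rewrite inE; apply/andP; split.
    by rewrite inE; apply/existsP; exists x; apply/existsP; exists y; rewrite xy eqxx.
  by apply/exists_inP; exists x => //; apply/exists_inP; exists y.
rewrite card_in_imset // => -[x y] [x' y']; rewrite !inE /=.
move=> /and3P[xA yA xy] /and3P[x'A y'A xy'] /(set2_eqP (adj_neq xy'))[] [hx hy].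
  by rewrite hx hy.
by move: y'A; rewrite -hx xA.
Qed.

(** At the sign vector of a cut the form equals [2 * m - 4 * cut_size], with [m] the number of
    edges; [qform_extreme] reduces the cube to such vectors. *)
Lemma cuts_bounded_surplus (beta : R) :
    (forall A, (cut_size A)%:R <= #|edges G|%:R / 2 + beta) ->
  bounded_surplus (@adj G) (4 * beta).
Proof.
move=> hcut x hx.
have [A] := qform_extreme (@adj_sym G) (@adj_irrefl G) hx.
apply: le_trans; rewrite qform_ind_sub; last exact: adj_sym.
have := arcs_setD R (@adj_sym G) (subsetT A).
rewrite setTD arcsT_edges arcs_cut; have := hcut A; lra.
Qed.
End CutsOfGraphs.

(** * Large cliques *)

Section LargeClique.
Variables (R : rcfType) (V : finType) (e : rel V).
Hypotheses (esym : symmetric e) (eirr : irreflexive e).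

(** [arcs_or_clique] with [D = 2 * k ^ 2] gives either the clique or so many arcs that
    [nonadj_discrepancy] contradicts the bound on [sigma]. *)
Lemma clique_in_near_clique (S : {set V}) (k : nat) (sigma eps : R) :
    (0 < k)%N -> 0 < eps -> 2 ^+ 12 * k%:R * eps <= 1 -> bounded_surplus e sigma ->
    4 * sigma < #|S|%:R * k%:R / 40 ->
    \sum_(u in S) \sum_(w in S) (nonadj e u w)%:R <= eps * #|S|%:R ^+ 2 ->
  exists2 K, clique e K & (#|S| <= 16 * k ^ 2 * #|K|)%N.
Proof.
move=> k0 e0 ke hs hk hS.
have kp : 0 < k%:R :> R by rewrite ltr0n.
have sigma0 : 0 <= sigma.
  have := surplus_on_card hs (surplus_on0 e 1).
  by rewrite cards0 mulr0.
have n0 : 0 < #|S|%:R :> R by nra.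
(* By Markov's inequality this keeps at least half of [S], and makes the bound on [codegree]
   uniform. *)
pose S1 := [set u in S | codegree R e S u <= 2 * eps * #|S|%:R].
have sS1 : S1 \subset S by apply/subsetP => u; rewrite inE => /andP[].
have hS1 : #|S|%:R <= 2 * #|S1|%:R :> R.
  have cS : #|S|%:R = #|S1|%:R + #|S :\: S1|%:R :> R.
    by rewrite -natrD -(cardsID S1 S) (setIidPr sS1).
  have : #|S :\: S1|%:R * (2 * eps * #|S|%:R) <= eps * #|S|%:R ^+ 2.
    apply: le_trans hS; rewrite mulr_natl -sumr_const [leRHS](big_setID S1) /=.
    apply: le_trans (_ : \sum_(u in S :\: S1) codegree R e S u <= _).
      apply: ler_sum => u; rewrite !inE => /andP[+ uS]; rewrite uS /= -ltNge.
      exact: ltW.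
    by rewrite lerDr; do 2!(apply: sumr_ge0 => ? _).
  rewrite expr2 (_ : #|S :\: S1|%:R * _ = eps * #|S|%:R * (2 * #|S :\: S1|%:R)); last by ring.
  rewrite [eps * (_ * _)]mulrA ler_pM2l; last by rewrite mulr_gt0.
  lra.
have n10 : (0 < #|S1|)%N by rewrite -(ltr0n R); lra.
have D0 : (0 < 2 * k ^ 2)%N by rewrite muln_gt0 expn_gt0 k0.
have [F bF [hF|[K cK hK]]] := arcs_or_clique esym S1 D0; last first.
  exists K => //; rewrite -(ler_nat R); apply: le_trans hS1 _.
  have := hK; rewrite -(ler_nat R) !natrM; lra.
exfalso.
have := @nonadj_discrepancy R V e esym eirr S1 F k sigma (2 * eps * #|S|%:R) k0 n10 hs bF hF.
have hD u : u \in S1 -> codegree R e S1 u <= 2 * eps * #|S|%:R.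
  rewrite inE => /andP[_]; apply: le_trans.
  by rewrite [leRHS](big_setID S1) /= (setIidPr sS1) lerDl sumr_ge0.
move=> /(_ hD).
have h1 : #|S|%:R * k%:R <= 2 * #|S1|%:R * k%:R :> R by rewrite ler_pM2r.
have h2 : (2 ^+ 12 * k%:R * eps) * (#|S|%:R * k%:R) <= #|S|%:R * k%:R.
  by rewrite ler_piMl // mulr_ge0 // ltW.
rewrite (_ : 50 * (2 * eps * #|S|%:R) * k%:R ^+ 2
   = 100 * eps * #|S|%:R * k%:R ^+ 2); last by ring.
have h3 : 0 <= eps * #|S|%:R * k%:R ^+ 2 by rewrite !mulr_ge0 ?exprn_ge0 ?ltW.
have h4 : 2 ^+ 12 * (eps * #|S|%:R * k%:R ^+ 2) <= #|S|%:R * k%:R.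
  by apply: le_trans h2; rewrite le_eqVlt; apply/orP; left; apply/eqP; ring.
(* The discrepancy is at least [#|S| * k / 20], while [4 * sigma] stays below half of this and the
   codegree term is at most [100 / 2 ^ 12 < 1 / 40] times [#|S| * k]. *)
lra.
Qed.

Lemma large_clique (s a sigma : R) (b g t h l : nat) :
    1 <= a -> 0 < s -> arcs R e setT setT = 2 * s ^+ 2 ->
    bounded_surplus e sigma -> sigma <= 4 * a * s ->
    2 ^+ 16 * a ^+ 2 < b%:R -> 2 ^+ 29 * b%:R * a ^+ 4 <= 2 ^+ g ->
    2 ^+ 33 * b%:R * a ^+ 2 <= t%:R ->
    h = ((g + 2) * t + g + 1)%N -> l = ((h + 2) * t + h + 1)%N ->
    16 * a <= s -> 3 * t%:R * 2 ^+ l <= s ->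
  exists2 K, clique e K & s <= 2 ^+ 10 * a * b%:R ^+ 2 * #|K|%:R.
Proof.
move=> a1 s0 hE hs hsig hb hg ht hE' lE sa sl.
have a0 : 0 < a by exact: lt_le_trans a1.
have b0 : 0 < b%:R :> R by apply: le_lt_trans hb; rewrite mulr_ge0 ?exprn_ge0 ?ltW.
have ss0 : 0 < s ^+ 2 by rewrite exprn_gt0.
(* There are [2 * s ^ 2] arcs, so [X] has at most [s / 2] vertices and spans at most [s ^ 2 / 4]
   arcs; [arcs_split_le] then leaves most of them in [Y]. *)
pose X := [set v | 4 * s < degree R e setT v].
pose Y := setT :\: X.
have cX : #|X|%:R <= s / 2.
  have : #|X|%:R * (4 * s) <= 2 * s ^+ 2.
    rewrite -hE arcsE mulr_natl -sumr_const [leRHS](big_setID X) /= setTI.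
    apply: le_trans (_ : \sum_(u in X) degree R e setT u <= _).
      by apply: ler_sum => u; rewrite inE => /ltW.
    by rewrite lerDl; do 2!(apply: sumr_ge0 => ? _).
  rewrite expr2 (_ : #|X|%:R * (4 * s) = s * (4 * #|X|%:R)); last by ring.
  rewrite (_ : 2 * (s * s) = s * (2 * s)); last by ring.
  by rewrite ler_pM2l //; lra.
have hsa : sigma <= s ^+ 2 / 4 by rewrite expr2; nra.
have aY : s ^+ 2 / 2 <= arcs R e Y Y.
  have := arcs_split_le esym hs (subsetT X); rewrite hE.
  have : arcs R e X X <= s ^+ 2 / 4.
    apply: le_trans (arcs_le _ _ _ _) _; have : 0 <= #|X|%:R :> R by [].
    by rewrite expr2; nra.
  rewrite -/Y; lra.
have [U [sU cU aU']] := dense_core esym eirr Y hs.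
have aU : s ^+ 2 / 8 <= arcs R e U U by lra.
have cU1 : #|U|%:R <= 4 * a * s by exact: le_trans hsig.
have cU2 : s / 3 <= #|U|%:R.
  have h1 := le_trans aU (arcs_le _ _ _ _).
  rewrite leNgt; apply/negP => h2; have h3 : 0 <= #|U|%:R :> R by [].
  have : #|U|%:R * #|U|%:R <= s / 3 * (s / 3) by apply: ler_pM => //; exact: ltW.
  by move: h1 ss0; rewrite expr2; lra.
have hd v : v \in U -> degree R e U v <= 4 * s.
  move=> vU; have := subsetP sU v vU; rewrite !inE andbT -leNgt; apply: le_trans.
  by rewrite [leRHS](big_setID U) /= setTI lerDl sumr_ge0.
have t0 : 0 < t%:R :> R.
  by apply: lt_le_trans ht; rewrite !mulr_gt0 // exprn_gt0.
have tn0 : (0 < t)%N by rewrite -(ltr0n R).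
have tU : (t * 2 ^ l <= #|U|)%N.
  by rewrite -(ler_nat R) natrM natrX; lra.
have := few_cherries esym eirr hs hd hE' lE tn0 tU.
(* The largest [eps] that [clique_in_near_clique] accepts for [k = b]. *)
pose eps : R := (2 ^+ 12 * b%:R)^-1.
have e0 : 0 < eps by rewrite invr_gt0 mulr_gt0 // exprn_gt0.
have be : 2 ^+ 12 * b%:R * eps = 1 by rewrite mulfV // gt_eqF // mulr_gt0 // exprn_gt0.
have hg0 : 0 < 2 ^+ g :> R by rewrite exprn_gt0.
(* Each of the two terms of [few_cherries] gets half of the cherries allowed by
   [clique_like_neighbourhood]: [g] is chosen for the first and [t] for the second. *)
have h1 : #|U|%:R ^+ 3 / 2 ^+ g <= eps * s ^+ 3 / (2 ^+ 11 * a).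
  rewrite ler_pdivrMr // mulrAC.
  apply: le_trans (_ : (4 * a * s) ^+ 3 <= _).
    by rewrite ler_pXn2r ?nnegrE // !mulr_ge0 // ltW.
  rewrite ler_pdivlMr; last by rewrite mulr_gt0 // exprn_gt0.
  have -> : (4 * a * s) ^+ 3 * (2 ^+ 11 * a) = s ^+ 3 * (2 ^+ 17 * a ^+ 4) by ring.
  rewrite [eps * s ^+ 3]mulrC -[s ^+ 3 * eps * _]mulrA ler_pM2l; last by rewrite exprn_gt0.
  have -> : 2 ^+ 17 * a ^+ 4 = eps * (2 ^+ 29 * (b%:R * a ^+ 4)).
    rewrite -[LHS]mul1r -[X in X * _]be; ring.
  rewrite ler_pM2l //; by rewrite mulrA.
have h2 : 9 * (4 * s) ^+ 2 * sigma / t%:R <= eps * s ^+ 3 / (2 ^+ 11 * a).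
  rewrite ler_pdivrMr // [_ / _ * _]mulrAC ler_pdivlMr; last by rewrite mulr_gt0 // exprn_gt0.
  apply: le_trans (_ : 9 * (4 * s) ^+ 2 * (4 * a * s) * (2 ^+ 11 * a) <= _).
    rewrite ler_pM2r; last by rewrite mulr_gt0 // exprn_gt0.
    by rewrite ler_pM2l // mulr_gt0 // exprn_gt0 // mulr_gt0.
  have -> : 9 * (4 * s) ^+ 2 * (4 * a * s) * (2 ^+ 11 * a) = s ^+ 3 * (9 * 2 ^+ 17 * a ^+ 2) by ring.
  rewrite [eps * s ^+ 3]mulrC -[s ^+ 3 * eps * _]mulrA ler_pM2l; last by rewrite exprn_gt0.
  have -> : 9 * 2 ^+ 17 * a ^+ 2 = eps * (9 * 2 ^+ 29 * (b%:R * a ^+ 2)).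
    rewrite -[LHS]mul1r -[X in X * _]be; ring.
  rewrite ler_pM2l //; apply: le_trans ht; rewrite -[2 ^+ 33 * _ * _]mulrA.
  by apply: ler_wpM2r; [rewrite mulr_ge0 // exprn_ge0 // ltW | lra].
move=> hch.
have hch' : cherries R e U <= eps * s ^+ 3 / (2 ^+ 10 * a).
  apply: le_trans hch _; apply: le_trans (lerD h1 h2) _.
  by rewrite le_eqVlt; apply/orP; left; apply/eqP; field; rewrite gt_eqF.
have [S [nS hS]] := clique_like_neighbourhood s0 a0 e0 cU1 aU hch'.
have bn0 : (0 < b)%N by rewrite -(ltr0n R).
have [||K cK hK] := @clique_in_near_clique S b sigma eps bn0 e0 _ hs _ hS.
- by rewrite be.
- apply: le_lt_trans (_ : 16 * a * s < _); first by lra.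
  apply: lt_le_trans (_ : s / (64 * a) * b%:R / 40 <= _); last first.
    by rewrite ler_pM2r ?ler_pM2r // ?invr_gt0.
  rewrite (_ : s / (64 * a) * b%:R / 40 = s * b%:R / (64 * a * 40)); last by field; rewrite gt_eqF.
  rewrite ltr_pdivlMr; last by rewrite !mulr_gt0.
  rewrite (_ : 16 * a * s * (64 * a * 40) = s * (40 * 2 ^+ 10 * a ^+ 2)); last by ring.
  by rewrite ltr_pM2l //; have := sqr_ge0 a; lra.
exists K => //; move: hK; rewrite -(ler_nat R) !natrM => hK.
have := le_trans nS hK; rewrite ler_pdivrMr ?mulr_gt0 // => h3.
apply: le_trans h3 _; rewrite le_eqVlt; apply/orP; left; apply/eqP.
ring.
Qed.
End LargeClique.

(** * Growth of the parameters *)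

Section Exponents.
Local Open Scope nat_scope.

(** In orders of magnitude [k] is [a ^ 2], [t] is [a ^ 4], [h] is [g * t] and [l] is [h * t]. A
    logarithmic [g] would do; taking it linear in [a] gives [h] of order [a ^ 5] and [l] of order
    exactly [a ^ 9]. *)
Lemma exponent_bound (b : nat) : 0 < b -> exists C, forall a, 0 < a ->
  exists k t g h l, [/\ k = b * a ^ 2, t = b * k * a ^ 2 /\ b * k * a ^ 4 <= 2 ^ g,
    h = (g + 2) * t + g + 1 /\ l = (h + 2) * t + h + 1,
    3 * t * 2 ^ l <= 2 ^ (C * a ^ 9) & 2 ^ 10 * a * k ^ 2 <= 2 ^ (C * a ^ 9)].
Proof.
move=> b0; pose G := 2 * b + 8; pose H := G * b ^ 2 + G; pose K := (H + 2) * (b ^ 2 + 1).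
exists (2 + b ^ 2 + K + (15 + 2 * b)) => a a0.
have self n : n <= 2 ^ n by exact: ltnW (ltn_expl n (leqnn 2)).
have pw i : 0 < a ^ i by rewrite expn_gt0 a0.
have mono i j : i <= j -> a ^ i <= a ^ j by move=> ij; rewrite leq_pexp2l.
pose k := b * a ^ 2; pose t := b * k * a ^ 2; pose g := 2 * b + 6 * a.
pose h := (g + 2) * t + g + 1; pose l := (h + 2) * t + h + 1.
exists k, t, g, h, l.
have tE : t = b ^ 2 * a ^ 4.
  by rewrite /t /k mulnA -mulnA -expnD -mulnn.
have hG : g + 2 <= G * a by rewrite /g /G mulnDl -mulnA; have := leq_pmulr b a0; lia.
have hH : h + 2 <= (H + 2) * a ^ 5.
  have h1 : (g + 2) * t <= G * b ^ 2 * a ^ 5.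
    rewrite tE (_ : G * b ^ 2 * a ^ 5 = (G * a) * (b ^ 2 * a ^ 4)); last first.
      by rewrite (expnD a 1 4) expn1; ring.
    by rewrite leq_mul2r hG orbT.
  have h2 : g + 1 + 2 <= (G + 2) * a ^ 5.
    apply: leq_trans (_ : (G + 2) * a <= _); first by rewrite mulnDl; lia.
    by rewrite leq_mul2l -{1}(expn1 a) mono ?orbT.
  rewrite /h /H -addnA -addnA (addnA g) -[_ + _ + 2]addnA !mulnDl.
  move: h1 h2; rewrite !mulnDl; lia.
have hK : l <= K * a ^ 9.
  have h1 : (h + 2) * t <= (H + 2) * b ^ 2 * a ^ 9.
    rewrite tE (_ : (H + 2) * b ^ 2 * a ^ 9 = ((H + 2) * a ^ 5) * (b ^ 2 * a ^ 4)); last first.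
      by rewrite (expnD a 5 4); ring.
    by rewrite leq_mul2r hH orbT.
  have h2 : (H + 2) * a ^ 5 <= (H + 2) * a ^ 9 by rewrite leq_mul2l mono ?orbT.
  by rewrite /K mulnDr muln1 mulnDl /l; lia.
split=> //.
- split=> //; rewrite /k /g (_ : b * (b * a ^ 2) * a ^ 4 = b * b * a ^ 6); last first.
    by rewrite (expnD a 2 4); ring.
  rewrite expnD; apply: leq_mul; first by rewrite mul2n -addnn expnD leq_mul.
  by rewrite mulnC expnM leq_exp2r.
- apply: leq_trans (_ : 2 ^ 2 * 2 ^ t * 2 ^ l <= _).
    by rewrite leq_mul2r leq_mul ?orbT // self.
  rewrite -!expnD leq_exp2l //.
  have : t <= b ^ 2 * a ^ 9 by rewrite tE leq_mul2l mono ?orbT.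
  by have := pw 9; move: hK; rewrite !mulnDl; lia.
- apply: leq_trans (_ : 2 ^ 10 * 2 ^ a * (2 ^ (2 * b) * 2 ^ (4 * a)) <= _).
    apply: leq_mul; first by rewrite leq_mul2l self orbT.
    rewrite /k expnMn -expnM.
    apply: leq_mul; first by rewrite mulnC expnM leq_exp2r.
    by rewrite [4 * a]mulnC [2 ^ (a * 4)]expnM leq_exp2r.
  rewrite -!expnD leq_exp2l //.
  have h1 : a <= a ^ 9 by rewrite -{1}(expn1 a) mono.
  have : b <= b * a ^ 9 by rewrite leq_pmulr.
  by have := pw 9; rewrite !mulnDl; lia.
Qed.
End Exponents.

(** For smaller [alpha] the core [U] would have fewer than [s / 2] vertices, too few to span the
    arcs that [dense_core] promises. The bound allows [alpha] to be rounded up to an integer within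
    a constant factor. *)
Lemma surplus_lower_bound (R : realFieldType) (V : finType) (e : rel V) (s alpha : R) :
    symmetric e -> irreflexive e -> 1 <= s -> 0 < alpha ->
    arcs R e setT setT = 2 * s ^+ 2 -> bounded_surplus e (4 * (alpha * s)) ->
  8^-1 <= alpha.
Proof.
move=> esym eirr s1 alpha0 hE hs; rewrite leNgt; apply/negP => small.
have [U [_ cU]] := dense_core esym eirr setT hs; rewrite hE.
have h0 : 0 <= #|U|%:R :> R by [].
have : #|U|%:R * #|U|%:R <= (s / 2) * (s / 2).
  by apply: ler_pM => //; nra.
have := arcs_le R e U U; rewrite expr2; nra.
Qed.

Theorem theorem1p7 (R : realType) :
  exists C : R, 0 < C /\
    forall (alpha : R) (G : sgraph) (m : nat),
      0 < alpha ->
      m = #|edges G| ->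
      (1 <= m)%N ->
      (forall A : {set G},
         (cut_size A)%:R <= m%:R / 2 + alpha * Num.sqrt (m%:R : R)) ->
      exists K : {set G},
        is_clique K /\
        2 `^ (- (C * alpha ^+ 9)) * Num.sqrt (m%:R : R) <= (#|K|)%:R.
Proof.
(* One constant dominating [2 ^ 16], [2 ^ 29] and [2 ^ 33] in [large_clique]. *)
have [b hb] : exists b : nat, 2 ^+ 33 <= b%:R :> R.
  by exists (2 ^ 33)%N; rewrite natrX.
have b0 : (0 < b)%N by rewrite -(ltr0n R); apply: lt_le_trans hb; rewrite exprn_gt0.
have [C0 hC] := exponent_bound b0.
(* The factor [9 ^ 9] pays for replacing [alpha] by an integer [a <= 9 * alpha]; the successor keeps
   the constant positive. *)
exists (C0.+1%:R * 9 ^+ 9); split; first by rewrite mulr_gt0 // exprn_gt0.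
move=> alpha G m alpha0 mE m1 hcut.
set s := Num.sqrt (m%:R : R) in hcut *.
have sE : s ^+ 2 = m%:R by rewrite sqr_sqrtr.
have s1 : 1 <= s by rewrite -sqrtr1 ler_wsqrtr // ler1n.
have s0 : 0 < s by exact: lt_le_trans s1.
have hs : bounded_surplus (@adj G) (4 * (alpha * s)).
  by apply: cuts_bounded_surplus; rewrite -mE.
have hE : arcs R (@adj G) setT setT = 2 * s ^+ 2 by rewrite arcsT_edges -mE sE.
have alpha8 := surplus_lower_bound (@adj_sym G) (@adj_irrefl G) s1 alpha0 hE hs.
pose a := (Num.truncn alpha).+1.
have [aA Aa] : alpha <= a%:R /\ a%:R <= 9 * alpha.
  have /andP[h1 h2] := truncn_itv (ltW alpha0).
  by rewrite /a; split; [exact: ltW | rewrite -natr1; lra].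
have a1 : 1 <= a%:R :> R by rewrite ler1n.
have a0 : 0 < a%:R :> R by exact: lt_le_trans a1.
pose E := (C0.+1 * a ^ 9)%N.
suff [K cK hK] : exists2 K : {set G}, clique (@adj G) K & s <= 2 ^+ E * #|K|%:R.
  exists K; split.
    by move=> x y xK yK; move/forall_inP: cK => /(_ x xK)/forall_inP/(_ y yK)/implyP.
  rewrite powRN mulrC ler_pdivrMr ?powR_gt0 //.
  apply: le_trans hK _; rewrite mulrC ler_wpM2l // -[2 ^+ E]powR_mulrn //.
  apply: ler_powR; first by rewrite ler1n.
  rewrite /E natrM natrX -mulrA ler_pM2l // -exprMn ler_pXn2r ?nnegrE //.
  by rewrite mulr_ge0 // ltW.
have [x xG] : exists x : G, x \in [set: G].
  have /card_gt0P[f] : (0 < #|edges G|)%N by rewrite -mE.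
  by rewrite inE => /existsP[x _]; exists x; rewrite inE.
(* For small [s] a single vertex is a large enough clique; otherwise [s] exceeds every size required
   by [large_clique]. *)
have [|big] := leP s (2 ^+ E).
  exists [set x]; last by rewrite cards1 mulr1.
  apply/forall_inP => u; rewrite inE => /eqP->; apply/forall_inP => v; rewrite inE => /eqP->.
  by rewrite eqxx.
have [k [t [g [h [l [kE [tE gE] [hE' lE] hl hk]]]]]] := hC a (ltn0Sn _).
have CE : (C0 * a ^ 9 <= E)%N by rewrite leq_mul2r leqnSn orbT.
have up n : (n <= 2 ^ (C0 * a ^ 9))%N -> n%:R <= 2 ^+ E :> R.
  by move=> hn; rewrite -natrX ler_nat (leq_trans hn) // leq_exp2l.
have := @large_clique R G (@adj G) (@adj_sym G) (@adj_irrefl G)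
   s a%:R (4 * (alpha * s)) k g t h l a1 s0 hE hs.
have kR : k%:R = b%:R * a%:R ^+ 2 :> R by rewrite kE natrM natrX.
have tR : t%:R = b%:R * k%:R * a%:R ^+ 2 :> R by rewrite tE !natrM expr2.
have gR : b%:R * k%:R * a%:R ^+ 4 <= 2 ^+ g :> R.
  by rewrite -!natrX -!natrM ler_nat.
have q0 : 0 < a%:R ^+ 2 :> R by rewrite exprn_gt0.
have k0 : 0 < k%:R :> R by rewrite kR mulr_gt0 // ltr0n.
case.
- by rewrite mulrA ler_pM2r // ler_pM2l.
- by rewrite kR ltr_pM2r //; apply: lt_le_trans hb; rewrite ltr_eXn2l ?ltr1n.
- apply: le_trans gR; rewrite ler_pM2r ?exprn_gt0 // ler_pM2r //.
  by apply: le_trans hb; rewrite ler_eXn2l ?ltr1n.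
- by rewrite tR ler_pM2r // ler_pM2r.
- exact: hE'.
- exact: lE.
- apply: le_trans (ltW big); rewrite -natrM; apply: up; apply: leq_trans hk.
  apply: leq_trans (leq_pmulr _ _); first by rewrite leq_mul2r orbT.
  by rewrite expn_gt0 -(ltr0n R) k0.
- by apply: le_trans (ltW big); rewrite -natrX -!natrM; apply: up.
move=> K cK hK; exists K => //; apply: le_trans hK _.
by rewrite ler_wpM2r // -(natrX R 2 10) -(natrX R k 2) -!natrM; apply: up.
Qed.
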